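(* Let $s_0=1,s_1,s_2,\ldots$ be a sequence of real numbers such that for every $N\in\mathbb{N}$ the Hankel matrices $(s_{i+j-2})_{1\le i,j\le N}$ and $(s_{i+j-1})_{1\le i,j\le N}$ are positive definite. The Stieltjes moment problem for $(s_k)$ is indeterminate if and only if both the length and the mass of the associated string are finite: $M_\infty<+\infty$ and $L_\infty<+\infty$.
   Context: The Stieltjes moment problem asks for a Borel measure $\rho$ on $[0,+\infty)$ with $s_k=\int\lambda^k\,d\rho(\lambda)$ for all $k\ge0$; it is determinate if it has only one solution and indeterminate if it has more than one. Let $A$ be the semi-infinite Jacobi matrix with off-diagonal entries $a_1,a_2,\ldots>0$ and diagonal entries $b_1,b_2,\ldots\in\mathbb{R}$ determined by the moments $(s_k)$ (so that $s_k=(A^ke_1,e_1)$ for all $k$). In the Stieltjes case there are unique positive numbers $m_1=1,m_2,m_3,\ldots$ (masses) and $l_1,l_2,\ldots$ (lengths) such that $$b_1=\frac{1}{m_1l_1},\qquad b_i=\frac1{m_i}\left(\frac1{l_{i-1}}+\frac1{l_i}\right)\ (i\ge2),\qquad a_i=\frac{1}{l_i\sqrt{m_im_{i+1}}}\ (i\ge1).$$ These define the associated string; its total mass and length are $M_\infty=\sum_{k=1}^\infty m_k$ and $L_\infty=\sum_{k=1}^\infty l_k$. *)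

(* Defs.v *)
From HB Require Import structures.
From mathcomp Require Import all_boot all_order all_algebra.
From mathcomp Require Import all_classical all_reals all_analysis.

Set Implicit Arguments.
Unset Strict Implicit.
Unset Printing Implicit Defensive.

Import Order.TTheory GRing.Theory Num.Theory.
Import numFieldNormedType.Exports.

Local Open Scope classical_set_scope.
Local Open Scope ring_scope.

(* All sequences are indexed from 0: the moments s_0, s_1, ... keep their
   numbering, while  a i, b i, m i, l i  stand for the mathematical
   a_{i+1}, b_{i+1}, m_{i+1}, l_{i+1}. *)

Definition posdefmx (R : realType) (N : nat) (A : 'M[R]_N) : Prop :=
  A^T = A /\ forall v : 'cV[R]_N, v != 0 -> 0 < (v^T *m A *m v) 0 0.

Definition hankel (R : realType) (s : nat -> R) (N : nat) : 'M[R]_N :=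
  \matrix_(i < N, j < N) s (i + j)%N.

Definition hankel_shift (R : realType) (s : nat -> R) (N : nat) : 'M[R]_N :=
  \matrix_(i < N, j < N) s (i + j).+1.

(* A Borel measure on [0, +oo) is encoded as a Borel measure on R for which
   the complement of [0, +oo) is null.  As lambda ^+ k is nonnegative on
   [0, +oo), finiteness of the integral already gives integrability. *)
Definition stieltjes_solution (R : realType) (s : nat -> R)
    (rho : {measure set (measurableTypeR R) -> \bar R}) : Prop :=
  rho (~` `[0, +oo[) = 0%E /\
  forall k : nat, (\int[rho]_(x in `[0%R, +oo[) (x ^+ k)%:E = (s k)%:E)%E.

(* Two solutions must differ on a Borel set: a measure in the library is a
   function on all sets, whose values on non-measurable sets are irrelevant. *)
Definition stieltjes_indeterminate (R : realType) (s : nat -> R) : Prop :=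
  exists rho1 rho2 : {measure set (measurableTypeR R) -> \bar R},
    [/\ stieltjes_solution s rho1, stieltjes_solution s rho2 &
      exists2 B : set (measurableTypeR R), measurable B & rho1 B <> rho2 B].

(* The product of the semi-infinite Jacobi matrix with off-diagonal a and
   diagonal b by the infinite column vector u. *)
Definition jacobi_mul (R : realType) (a b u : nat -> R) : nat -> R :=
  fun n => (if n is p.+1 then a p * u p else 0) + b n * u n + a n * u n.+1.

Definition e1 (R : realType) : nat -> R := fun n => (n == 0%N)%:R.

(* (A^k e_1, e_1) is the first component of A^k e_1. *)
Definition jacobi_of_moments (R : realType) (s a b : nat -> R) : Prop :=
  (forall i, 0 < a i) /\
  forall k, s k = iter k (jacobi_mul a b) (e1 R) 0%N.

Definition string_of_jacobi (R : realType) (a b m l : nat -> R) : Prop :=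
  [/\ (forall i, 0 < m i) /\ (forall i, 0 < l i),
      m 0%N = 1,
      b 0%N = 1 / (m 0%N * l 0%N),
      forall i, b i.+1 = 1 / m i.+1 * (1 / l i + 1 / l i.+1) &
      forall i, a i = 1 / (l i * Num.sqrt (m i * m i.+1))].

(* m and l are the masses and lengths of the string associated with the
   moments s. *)
Definition associated_string (R : realType) (s m l : nat -> R) : Prop :=
  exists a b : nat -> R, jacobi_of_moments s a b /\ string_of_jacobi a b m l.

Definition total_mass (R : realType) (m : nat -> R) : \bar R :=
  (\sum_(0 <= k <oo) (m k)%:E)%E.

Definition total_length (R : realType) (l : nat -> R) : \bar R :=
  (\sum_(0 <= k <oo) (l k)%:E)%E.

(* Main.v *)
(** In the coordinates [u_i = (-1)^i sqrt(m_i) v_i] the Jacobi matrix becomes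
the operator of a vibrating string, and the orthogonal polynomials become
[f_{i+1} = f_i - X l_i h_i], [h_{i+1} = h_i + m_{i+1} f_{i+1}]: for any solution
[rho], the [f_i] are orthogonal in [L^2(rho)] with squared norms [1/m_i], the
[h_i] are orthogonal in [L^2(t rho)] with squared norms [1/l_i], and both are at
least 1 on the negative half-line.

If the mass or the length is infinite, the Christoffel function of one of the
two families vanishes at every [-x < 0].  This forces the Stieltjes transform
of any solution at [-x]; hence all integrals of [(t + x)^-n] are determined,
and bounded approximations of indicators by polynomials in [x / (t + x)]
recover the tails of the measure.

If both are finite, cut the string after [n + 1] masses, with its right end either
fixed or free.  The spectral theorem turns each finite string into a discrete
measure with the right first moments.  The free string has an atom of mass
[1 / (m_0 + ... + m_n)] at 0, while for the fixed one the integral of [1/t] is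
[l_0 + ... + l_n].  A limit along an ultrafilter gives one solution with an
atom at 0 and one without. *)

Require Import Defs.
From HB Require Import structures.
From mathcomp Require Import all_boot all_order all_algebra.
From mathcomp Require Import complex.
From mathcomp Require Import all_classical all_reals all_analysis.
From mathcomp Require Import measurable_realfun.
From mathcomp Require Import zify ring lra.

Set Implicit Arguments.
Unset Strict Implicit.
Unset Printing Implicit Defensive.

Import Order.TTheory GRing.Theory Num.Theory.
Import numFieldNormedType.Exports.

Local Open Scope classical_set_scope.
Local Open Scope ring_scope.

(** * Spectral moments of a symmetric matrix *)

Section Spectral.
Context {R : realType}.
Local Open Scope sesquilinear_scope.

(** Over [R[i]], [S] is Hermitian, hence [P^-1 D P] with [P] unitary and [D] real diagonal. The
    weights are the squared moduli of the entries of column 0 of [P], and the nodes are the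
    eigenvalues. *)
Lemma symmetric_spectral_moments (n : nat) (S : 'M[R]_n.+1) : S^T = S ->
  exists w d : 'I_n.+1 -> R, (forall j, 0 <= w j) /\
    forall k, (S ^+ k) 0 0 = \sum_j w j * d j ^+ k.
Proof.
move=> symS; pose T : 'M[R[i]]_n.+1 := map_mx (real_complex R) S.
have hermT : T \is hermsymmx.
  apply/is_hermitianmxP; rewrite expr0 scale1r /T.
  apply/matrixP => i j; rewrite !mxE -[in RHS]symS mxE.
  by apply/esym/conj_Creal; rewrite complex_real.
have [P [D [TE Punitary dreal]]] : exists P D,
    [/\ T = invmx P *m diag_mx D *m P, P \is unitarymx &
        forall j, D 0 j \is Num.real].
  exists (spectralmx T), (spectral_diag T); split.
  - by have /hermitian_normalmx/orthomx_spectralP := hermT.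
  - exact: spectral_unitarymx.
  - by move=> j; have /mxOverP := hermitian_spectral_diag_real hermT; exact.
have Punit : P \in unitmx by exact: unitarymx_unit.
have TkE k : T ^+ k = invmx P *m diag_mx (map_mx (fun x => x ^+ k) D) *m P.
  elim: k => [|k IH].
    rewrite expr0 (_ : diag_mx _ = 1%:M) ?mulmx1 ?mulVmx//.
    by apply/matrixP => i j; rewrite !mxE expr0.
  have -> : T ^+ k.+1 = T *m T ^+ k by rewrite exprS.
  rewrite IH {1}TE -!mulmxA; congr (_ *m _).
  rewrite (mulmxA P) mulmxV// mul1mx mulmxA; congr (_ *m _).
  by apply/matrixP => i j; rewrite mul_diag_mx !mxE mulrnAr -exprS.
exists (fun j => complex.Re (P j 0 * (P j 0)^*)), (fun j => complex.Re (D 0 j)).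
have wE j : (complex.Re (P j 0 * (P j 0)^*))%:C%C = (P j 0 * (P j 0)^*).
  rewrite RRe_real// -normCK; apply: ger0_real; exact: exprn_ge0.
split=> [j|k].
  by rewrite -lecR wE -normCK exprn_ge0.
apply: (@complexI R).
have -> : ((S ^+ k) 0 0)%:C%C = (T ^+ k) 0 0.
  have -> : T ^+ k = map_mx (real_complex R) (S ^+ k) by rewrite rmorphXn.
  by rewrite mxE.
rewrite TkE invmx_unitary // mxE rmorph_sum/=.
apply: eq_bigr => j _; rewrite rmorphM rmorphXn /= wE RRe_real//.
rewrite mul_mx_diag !mxE/=.
by rewrite mulrC mulrA.
Qed.

End Spectral.

(** * The string operator *)

Section StringOperator.
Context {R : realType}.
Implicit Types (kap mu v : nat -> R) (p q : {poly R}).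

(* The Jacobi matrix in the coordinates [u i = (-1)^i sqrt (m i) v i], with
   [mu i = 1 / m i] and [kap i = 1 / l i]; unlike masses and lengths, these
   weights may vanish, which truncates the string. *)
Definition string_op kap mu v : nat -> R := fun n =>
  mu n * ((if n is j.+1 then kap j * (v n - v j) else 0)
          + kap n * (v n - v n.+1)).

(** The vector [p(T) e_1] for [T = string_op kap mu]. With the inverse lengths and masses of the
    associated string, its component 0 is the moment functional at [p]. *)
Definition krylov kap mu p : nat -> R := fun n =>
  \sum_(k < size p) p`_k * iter k (string_op kap mu) (e1 R) n.

Lemma krylov_widen kap mu p n N : (size p <= N)%N ->
  krylov kap mu p n = \sum_(k < N) p`_k * iter k (string_op kap mu) (e1 R) n.
Proof.
move=> pN; rewrite /krylov (big_ord_widen N (fun k =>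
  p`_k * iter k (string_op kap mu) (e1 R) n))// big_mkcond/=.
apply: eq_bigr => k _; case: ifPn => //; rewrite -leqNgt => pk.
by rewrite nth_default// mul0r.
Qed.

Lemma krylovD kap mu p q n :
  krylov kap mu (p + q) n = krylov kap mu p n + krylov kap mu q n.
Proof.
pose N := maxn (size p) (size q).
rewrite !(@krylov_widen _ _ _ _ N) ?leq_maxl ?leq_maxr ?size_polyD//.
by rewrite -big_split/=; apply: eq_bigr => k _; rewrite coefD mulrDl.
Qed.

Lemma krylovZ kap mu c p n : krylov kap mu (c *: p) n = c * krylov kap mu p n.
Proof.
rewrite (@krylov_widen _ _ _ _ (size p)) ?size_scale_leq// mulr_sumr.
by apply: eq_bigr => k _; rewrite coefZ mulrA.
Qed.

Lemma krylovB kap mu p q n :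
  krylov kap mu (p - q) n = krylov kap mu p n - krylov kap mu q n.
Proof. by rewrite krylovD -scaleN1r krylovZ mulN1r. Qed.

Lemma krylov_sum kap mu (I : finType) (F : I -> {poly R}) n :
  krylov kap mu (\sum_i F i) n = \sum_i krylov kap mu (F i) n.
Proof.
elim/big_ind2: _ => [|x y p q <- <-|//]; last by rewrite krylovD.
by rewrite /krylov size_poly0 big_ord0.
Qed.

Lemma krylovXn kap mu k n :
  krylov kap mu 'X^k n = iter k (string_op kap mu) (e1 R) n.
Proof.
rewrite /krylov size_polyXn big_ord_recr/= coefXn eqxx mul1r big1 ?add0r// => i _.
by rewrite coefXn (ltn_eqF (ltn_ord i)) mul0r.
Qed.

Lemma krylovC kap mu c n : krylov kap mu c%:P n = c * e1 R n.
Proof. by rewrite -[c%:P]mulr1 mul_polyC krylovZ -(expr0 'X) krylovXn. Qed.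

Lemma string_op_sum kap mu (I : finType) (c : I -> R) (F : I -> nat -> R) n :
  string_op kap mu (fun i => \sum_k c k * F k i) n =
  \sum_k c k * string_op kap mu (F k) n.
Proof.
rewrite /string_op; case: n => [|n];
  rewrite ?add0r -?sumrB !mulr_sumr -?big_split/= ?mulr_sumr;
  by apply: eq_bigr => k _; ring.
Qed.

Lemma krylovMX kap mu p n :
  krylov kap mu (p * 'X) n = string_op kap mu (krylov kap mu p) n.
Proof.
rewrite (@krylov_widen _ _ _ _ (size p).+1); last first.
  by rewrite (leq_trans (size_polyMleq _ _))// size_polyX addn2.
rewrite big_ord_recl coefMX/= mul0r add0r string_op_sum.
by apply: eq_bigr => k _; rewrite coefMX.
Qed.

(** The polynomials annihilating [e_1] form an ideal. *)
Lemma krylov_eq0M kap mu p q : (forall n, krylov kap mu q n = 0) ->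
  forall n, krylov kap mu (p * q) n = 0.
Proof.
move=> q0; elim/poly_ind: p => [|p c IH] n.
  by rewrite mul0r /krylov size_poly0 big_ord0.
rewrite mulrDl krylovD mulrAC krylovMX mul_polyC krylovZ q0 mulr0 addr0.
by rewrite /string_op; case: n => [|n]; rewrite ?IH !subrr !mulr0 ?addr0 ?mulr0.
Qed.

(** Finite propagation: [k] applications of the operator to [e_1] reach only the indices up to [k],
    so weights further out do not enter. *)
Lemma eq_iter_string_op n kap mu kap' mu' :
  (forall i, (i < n)%N -> kap i = kap' i) ->
  (forall i, (i <= n)%N -> mu i = mu' i) ->
  forall k, (k <= n)%N -> forall i,
    iter k (string_op kap mu) (e1 R) i = iter k (string_op kap' mu') (e1 R) i.
Proof.
move=> ekap emu.
have supp kp m k : forall i, (k < i)%N -> iter k (string_op kp m) (e1 R) i = 0.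
  elim: k => [[]//|k IH] [//|i]; rewrite ltnS => ki /=.
  by rewrite /string_op !IH ?subrr ?mulr0 ?addr0 ?mulr0//; lia.
elim=> [//|k IH] kn i /=.
have {}IH := IH (ltnW kn).
have [ki|ik] := ltnP k.+1 i.
  by rewrite -!/(iter k.+1 _ _) !supp.
rewrite /string_op emu ?(leq_trans ik)//; congr (_ * (_ + _)); last first.
  rewrite !IH; have [ik'|ki'] := ltnP i n; first by rewrite ekap.
  by rewrite !supp ?subrr ?mulr0//; lia.
case: i ik => // i ik; rewrite !IH.
by rewrite ekap// (leq_trans _ kn).
Qed.

Lemma eq_krylov n kap mu kap' mu' p :
  (forall i, (i < n)%N -> kap i = kap' i) ->
  (forall i, (i <= n)%N -> mu i = mu' i) -> (size p <= n.+1)%N ->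
  forall i, krylov kap mu p i = krylov kap' mu' p i.
Proof.
move=> ekap emu pn i; apply: eq_bigr => k _.
by rewrite (eq_iter_string_op ekap emu)// -ltnS (leq_trans _ pn).
Qed.

(** The operator is [diag(mu) C] with [C] symmetric tridiagonal. Conjugation by [sqrt mu] makes it
    the symmetric matrix [S], and the vanishing of [mu] beyond [n] makes it finite. *)
Lemma gauss_quadrature n kap mu : (forall i, 0 <= mu i) -> mu 0%N = 1 ->
  (forall i, (n < i)%N -> mu i = 0) ->
  exists w d : 'I_n.+1 -> R, (forall j, 0 <= w j) /\
    forall p, krylov kap mu p 0%N = \sum_j w j * p.[d j].
Proof.
move=> mu0 mu01 mun.
pose C (i j : nat) : R :=
  (i == j)%:R * ((if i is k.+1 then kap k else 0) + kap i)
  - (j == i.+1)%:R * kap i - (i == j.+1)%:R * kap j.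
have CC i j : C i j = C j i.
  by rewrite /C (eq_sym j i) addrAC; case: eqP => [->//|_]; rewrite !mul0r.
pose S : 'M[R]_n.+1 := \matrix_(i, j) (Num.sqrt (mu i) * C i j * Num.sqrt (mu j)).
have symS : S^T = S.
  by apply/matrixP => i j; rewrite !mxE (CC j i) mulrC [X in _ * X]mulrC mulrA.
have [w [d [w0 wd]]] := symmetric_spectral_moments symS.
(* Row [n] of the operator still involves [v n.+1], a column that the finite block omits; hence the
   condition on [v]. *)
have opE v i : v n.+1 = 0 -> (i <= n)%N ->
    string_op kap mu v i = mu i * \sum_(j < n.+1) C i j * v j.
  move=> vn i_n; rewrite /string_op; congr (_ * _).
  have pick a (F : nat -> R) : \sum_(j < n.+1) (a == j :> nat)%:R * F j =
      (a < n.+1)%:R * F a.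
    have [an|na] := ltnP a n.+1.
      rewrite (bigD1 (Ordinal an))//= eqxx big1 ?addr0// => j.
      by rewrite -val_eqE/= eq_sym => /negPf ->; rewrite mul0r.
    rewrite mul0r big1// => j _; rewrite gtn_eqF ?mul0r//.
    by rewrite (leq_trans _ na).
  under eq_bigr do rewrite /C !mulrBl -!mulrA (eq_sym _ i.+1).
  rewrite !sumrB (pick i (fun j => _ * v j)) ltnS i_n mul1r.
  rewrite (pick i.+1 (fun j => kap i * v j)).
  have -> : (i.+1 < n.+1)%:R * (kap i * v i.+1) = kap i * v i.+1.
    have [_|ni] := ltnP i.+1 n.+1; first by rewrite mul1r.
    by rewrite (_ : i.+1 = n.+1) ?vn ?mulr0//; lia.
  case: i i_n => [|i] i_n.
    by rewrite big1 => [|j _]; rewrite ?mul0r//; ring.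
  under [X in _ = _ - X]eq_bigr do rewrite eqSS.
  by rewrite (pick i (fun j => kap j * v j)) ltnS (ltnW i_n) mul1r; ring.
(* The conjugation is written without division, because [mu i] may vanish. *)
have iterE k i (i_n : (i < n.+1)%N) :
    iter k (string_op kap mu) (e1 R) i =
    Num.sqrt (mu i) * (S ^+ k) (Ordinal i_n) 0.
  elim: k i i_n => [|k IH] i i_n.
    rewrite expr0 !mxE /= /e1 -val_eqE/=.
    by case: i i_n => [|i] i_n; rewrite ?mu01 ?sqrtr1 ?mulr1//= mulr0.
  rewrite iterS opE//; last first.
    by case: k {IH} => //= k; rewrite /string_op mun// mul0r.
  rewrite exprS mxE -{1}(sqr_sqrtr (mu0 i)) expr2 -mulrA; congr (_ * _).
  rewrite mulr_sumr; apply: eq_bigr => -[j jn] _; rewrite mxE /= IH.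
  by rewrite !mulrA.
exists w, d; split=> // p.
rewrite /krylov; under eq_bigr do
  rewrite (@iterE _ 0%N (ltn0Sn n)) mu01 sqrtr1 mul1r (_ : Ordinal _ = 0)// wd mulr_sumr.
rewrite exchange_big/=; apply: eq_bigr => j _.
rewrite horner_coef mulr_sumr; apply: eq_bigr => k _.
by rewrite mulrCA.
Qed.

End StringOperator.

(** * Polynomials of the string *)

Section StringPolynomials.
Context {R : realType}.
Variables m l : nat -> R.

(* The pair [(f_i, h_i)]: if the vector [v] solves [string_op v = x v] and
   [v 0 = 1], then [v i = f_i(x)], and [h_i(x)] is the sum of [m j v j] over
   [j <= i]. *)
Fixpoint string_poly (i : nat) : {poly R} * {poly R} :=
  if i is j.+1 then
    let f := (string_poly j).1 - l j *: ((string_poly j).2 * 'X) in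
    (f, (string_poly j).2 + m j.+1 *: f)
  else (1, (m 0%N)%:P).

Notation f i := (string_poly i).1.
Notation h i := (string_poly i).2.

Lemma string_polyS2 i : h i.+1 = h i + m i.+1 *: f i.+1. Proof. by []. Qed.

Lemma size_string_poly i : (size (f i) <= i.+1)%N /\ (size (h i) <= i.+1)%N.
Proof.
elim: i => [|i [fi hi]]; first by rewrite /= size_poly1 size_polyC_leq1.
have fS : (size (f i.+1) <= i.+2)%N.
  rewrite /= (leq_trans (size_polyD _ _))// geq_max (leq_trans fi)//=.
  rewrite size_polyN (leq_trans (size_scale_leq _ _))//.
  by rewrite (leq_trans (size_polyMleq _ _))// size_polyX addn2.
split=> //=; rewrite (leq_trans (size_polyD _ _))// geq_max (leq_trans hi)//=.
by rewrite (leq_trans (size_scale_leq _ _)).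
Qed.

Lemma string_poly_sum n :
  f n = 1 - (\sum_(i < n) l i *: h i) * 'X.
Proof.
elim: n => [|n IH]; first by rewrite big_ord0 mul0r subr0.
by rewrite big_ord_recr/= IH mulrDl opprD addrA scalerAl.
Qed.

Lemma string_poly_at0 i : (f i).[0] = 1 /\ (h i).[0] = \sum_(j < i.+1) m j.
Proof.
have f0 j : (f j).[0] = 1.
  by rewrite string_poly_sum !hornerE ?mulr0 ?subr0.
split=> //; elim: i => [|i IH]; first by rewrite big_ord1 hornerC.
by rewrite big_ord_recr string_polyS2 hornerD hornerZ IH f0 mulr1.
Qed.

Hypotheses (m_gt0 : forall i, 0 < m i) (l_gt0 : forall i, 0 < l i).
Hypothesis m0 : m 0%N = 1.

(** For [x <= 0] both recurrences only add nonnegative terms to the initial value 1. *)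
Lemma string_poly_ge1 x i : x <= 0 -> 1 <= (f i).[x] /\ 1 <= (h i).[x].
Proof.
move=> x0; elim: i => [|i [fi hi]]; first by rewrite !hornerE m0.
have fS : 1 <= (f i.+1).[x].
  rewrite /= !hornerE (le_trans fi)// lerBrDl gerDr.
  rewrite ?mulrA mulr_ge0_le0// mulr_ge0// ?(ltW (l_gt0 _))//.
  by rewrite (le_trans ler01).
split=> //; rewrite string_polyS2 hornerD hornerZ.
by rewrite (le_trans hi)// lerDl mulr_ge0// ?(ltW (m_gt0 _))// (le_trans ler01).
Qed.

Variables (kap mu : nat -> R) (n : nat).
Hypothesis lkap : forall i, (i < n)%N -> l i * kap i = 1.
Hypothesis mmu : forall i, (i <= n)%N -> m i * mu i = 1.
Notation V := (krylov kap mu).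

(** The internal forces cancel in pairs, leaving the tension at the right end. Only the weights up
    to [n] are tied to [m] and [l], so this also covers truncated strings. *)
Lemma sum_mass_string_op v i : (i <= n)%N ->
  \sum_(j < i.+1) m j * string_op kap mu v j = kap i * (v i - v i.+1).
Proof.
elim: i => [|i IH] i_n; first by rewrite big_ord1 mulrA mmu// mul1r add0r.
by rewrite big_ord_recr/= IH 1?ltnW// mulrA mmu// mul1r addrA -mulrDr; ring.
Qed.

(** The first row of [f_i(T)] is the coordinate functional of index [i]: by [sum_mass_string_op],
    the recurrence for [f] recovers [v (i + 1)] from [v i] and the tension between them. *)
Lemma krylov_string_poly_row i q : (i <= n)%N ->
  V (f i * q) 0%N = V q i /\
  V (h i * q) 0%N = \sum_(j < i.+1) m j * V q j.
Proof.
elim: i q => [|i IH] q i_n.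
  by rewrite mul1r big_ord1 /= mul_polyC krylovZ.
have [fi hi] := IH q (ltnW i_n).
have fS : V (f i.+1 * q) 0%N = V q i.+1.
  rewrite /= mulrBl krylovB fi -scalerAl krylovZ -mulrA (mulrC 'X).
  have [_ ->] := IH (q * 'X) (ltnW i_n).
  under eq_bigr do rewrite krylovMX.
  by rewrite sum_mass_string_op 1?ltnW// mulrA lkap// mul1r opprB addrCA subrr addr0.
split=> //.
by rewrite big_ord_recr string_polyS2 mulrDl krylovD hi -scalerAl krylovZ fS.
Qed.

(** A displacement constant up to [i] and zero afterwards stretches only the link between [i] and
    [i.+1]. *)
Lemma string_op_initial i k :
  string_op kap mu (fun j => (j <= i)%:R) k =
  kap i * (mu i * (k == i)%:R - mu i.+1 * (k == i.+1)%:R).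
Proof.
rewrite /string_op; case: k => [|k].
  by case: i => [|i]; rewrite ?eqxx ?ltnS ?leq0n ?ltn0 ?eqSS/=; ring.
have -> : (k.+1 <= i)%N = (k.+1 == i) || (k.+2 <= i)%N by lia.
have -> : (k <= i)%N = [|| k == i, k.+1 == i | (k.+2 <= i)%N] by lia.
rewrite eqSS; have [->|ki] := eqVneq k i.
  by rewrite gtn_eqF// (_ : (i.+2 <= i)%N = false) ?orbF/=; [ring|lia].
have [->|ki'] := eqVneq k.+1 i; first by rewrite ltnn /=; ring.
by case: ltnP => _ /=; ring.
Qed.

(** The companion of the row lemma for first columns: each [h i] produces a step, on which
    [string_op_initial] computes the next [f]. Rows against columns will give orthogonality. *)
Lemma krylov_string_poly_col i : (i <= n)%N ->
  (forall k, V (f i) k = mu i * (k == i)%:R) /\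
  (forall k, V (h i) k = (k <= i)%:R).
Proof.
have mu01 : mu 0%N = 1 by rewrite -[LHS]mul1r -m0 mmu.
elim: i => [|i IH] i_n.
  split=> k.
    by rewrite /= krylovC mul1r /e1 mu01 mul1r.
  by rewrite /= krylovC m0 mul1r /e1 leqn0.
have [fi hi] := IH (ltnW i_n).
have hfun : krylov kap mu (h i) = fun j => (j <= i)%:R by apply/funext.
have fS k : V (f i.+1) k = mu i.+1 * (k == i.+1)%:R.
  rewrite /= krylovB krylovZ krylovMX fi hfun string_op_initial.
  by rewrite mulrA lkap// mul1r opprB addrCA subrr addr0.
split=> // k.
rewrite string_polyS2 krylovD krylovZ hi fS mulrA mmu// mul1r.
by rewrite (leq_eqVlt k i.+1) ltnS; case: eqVneq => [->|_]; rewrite ?ltnn ?add0r ?addr0.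
Qed.

(** The condition [mu n.+1 = 0] stands for an infinite mass, which pins the end of the last thread
    [l n]. *)
Lemma krylov_fixed_end : l n * kap n = 1 -> mu n.+1 = 0 ->
  forall k, V (f n.+1) k = 0.
Proof.
move=> lkn mun k; have [fn hn] := krylov_string_poly_col (leqnn n).
have hfun : krylov kap mu (h n) = fun j => (j <= n)%:R by apply/funext.
rewrite /= krylovB krylovZ krylovMX fn hfun string_op_initial mun mul0r subr0.
by rewrite (mulrA (l n)) lkn mul1r subrr.
Qed.

(** The condition [kap n = 0] removes the link after mass [n]. The constant displacement is then at
    rest, which is where the root at 0 comes from. *)
Lemma krylov_free_end : kap n = 0 -> forall k, V (h n * 'X) k = 0.
Proof.
move=> kn k; have [_ hn] := krylov_string_poly_col (leqnn n).
have hfun : krylov kap mu (h n) = fun j => (j <= n)%:R by apply/funext.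
by rewrite krylovMX hfun string_op_initial kn mul0r.
Qed.

End StringPolynomials.

(** * Truncated strings *)

Section TruncatedStrings.
Context {R : realType}.
Variables m l : nat -> R.
Hypotheses (m_gt0 : forall i, 0 < m i) (l_gt0 : forall i, 0 < l i).
Hypothesis m0 : m 0%N = 1.

Notation f i := (string_poly m l i).1.
Notation h i := (string_poly m l i).2.
Notation L p := (krylov (fun i => (l i)^-1) (fun i => (m i)^-1) p 0%N).

Lemma string_moment_ff i j : L (f i * f j) = (i == j)%:R / m i.
Proof.
have lk k : (k < maxn i j)%N -> l k * (l k)^-1 = 1 by rewrite mulfV ?gt_eqF.
have mk k : (k <= maxn i j)%N -> m k * (m k)^-1 = 1 by rewrite mulfV ?gt_eqF.
have [-> _] := krylov_string_poly_row lk mk (f j) (leq_maxl i j).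
have [-> _] := krylov_string_poly_col m0 lk mk (leq_maxr i j).
by rewrite mulrC; case: eqVneq => [->|]; rewrite ?mul0r.
Qed.

(** The row of [h i] sums forces, so it returns the tension after [i] of the step produced by [h j];
    this is nonzero only for [i = j]. *)
Lemma string_moment_hh i j : L (h i * h j * 'X) = (i == j)%:R / l i.
Proof.
have lk k : (k < maxn i j)%N -> l k * (l k)^-1 = 1 by rewrite mulfV ?gt_eqF.
have mk k : (k <= maxn i j)%N -> m k * (m k)^-1 = 1 by rewrite mulfV ?gt_eqF.
rewrite -mulrA.
have [_ ->] := krylov_string_poly_row lk mk (h j * 'X) (leq_maxl i j).
under eq_bigr do rewrite krylovMX.
rewrite (sum_mass_string_op _ mk) ?leq_maxl//.
have [_ hj] := krylov_string_poly_col m0 lk mk (leq_maxr i j).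
by rewrite !hj mulrC; congr (_ / _); case: ltngtP => _; rewrite ?subrr ?subr0.
Qed.

(* The extremal [r] is the normalized reproducing kernel
   [sum_i c_i F_i(x) F_i]. *)
Lemma christoffel_bound (F : nat -> {poly R}) (g : {poly R}) (c : nat -> R) x n :
  (forall i, 0 < c i) -> (forall i j, L (F i * F j * g) = (i == j)%:R / c i) ->
  (forall i, 1 <= (F i).[x]) ->
  exists r : {poly R}, r.[x] = 1 /\ L (r * r * g) <= (\sum_(i < n.+1) c i)^-1.
Proof.
move=> c_gt0 Forth F1.
pose K := \sum_(i < n.+1) c i * (F i).[x] ^+ 2.
(* The norm of the extremal polynomial is [1 / K]; since every [F_i(x)] is at least 1, [K] dominates
   the sum of the [c i]. *)
have sc0 : 0 < \sum_(i < n.+1) c i.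
  by rewrite big_ord_recl ltr_wpDr// sumr_ge0// => i _; exact: ltW.
have cK : \sum_(i < n.+1) c i <= K.
  by apply: ler_sum => i _; rewrite ler_peMr ?(ltW (c_gt0 i))// exprn_ege1.
have K0 : 0 < K by exact: lt_le_trans cK.
exists (K^-1 *: \sum_(i < n.+1) (c i * (F i).[x]) *: F i); split.
  rewrite hornerZ horner_sum.
  under eq_bigr do rewrite hornerZ -mulrA -expr2.
  by rewrite mulVf ?gt_eqF.
rewrite -!(scalerAl, scalerAr) !krylovZ !mulr_suml krylov_sum.
rewrite (_ : \sum_i _ = K); last first.
  apply: eq_bigr => i _; rewrite -!scalerAl krylovZ.
  rewrite [F i * _]mulr_sumr mulr_suml krylov_sum.
  rewrite (bigD1 i)//= big1 => [|j ji].
    rewrite -[F i * (_ *: _)]scalerAr -[(_ *: _) * g]scalerAl krylovZ Forth eqxx addr0 mul1r.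
    by field; rewrite gt_eqF.
  by rewrite -[F i * (_ *: _)]scalerAr -[(_ *: _) * g]scalerAl krylovZ Forth
       (eq_sym (i : nat)) val_eqE (negPf ji) mul0r mulr0.
by rewrite mulVf ?gt_eqF// mulr1 lef_pV2.
Qed.

Definition truncate (n : nat) (u : nat -> R) (i : nat) : R :=
  if (i <= n)%N then u i else 0.

Lemma truncated_moments n (kap : nat -> R) (p : {poly R}) :
  (forall i, (i < n)%N -> kap i = (l i)^-1) -> (size p <= n.+1)%N ->
  krylov kap (truncate n (fun i => (m i)^-1)) p 0%N = L p.
Proof.
by move=> kapE pn; apply: (eq_krylov kapE) pn _ => i i_n; rewrite /truncate i_n.
Qed.

(** A polynomial [t] annihilating [e_1] vanishes at every node of nonzero weight. As [t] has no
    negative root, these nodes are nonnegative. *)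
Lemma truncated_quadrature n (kap : nat -> R) (t : {poly R}) :
  let mu := truncate n (fun i => (m i)^-1) in
  (forall i, (i < n)%N -> kap i = (l i)^-1) ->
  (forall k, krylov kap mu t k = 0) -> (forall x, x < 0 -> t.[x] != 0) ->
  exists w d : 'I_n.+1 -> R, [/\ forall j, 0 <= w j, forall j, 0 <= d j,
    forall j, w j * t.[d j] = 0 &
    forall p : {poly R}, (size p <= n.+1)%N -> \sum_j w j * p.[d j] = L p].
Proof.
move=> mu kapE Vt t_neg.
have mu_ge0 i : 0 <= mu i.
  by rewrite /mu /truncate; case: ifP => // _; rewrite invr_ge0 ltW.
have mu01 : mu 0%N = 1 by rewrite /mu /truncate m0 invr1.
have mun i : (n < i)%N -> mu i = 0 by rewrite /mu /truncate ltnNge => /negPf ->.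
have [w [d [w0 wd]]] := gauss_quadrature kap mu_ge0 mu01 mun.
have wt j : w j * t.[d j] = 0.
  (* The quadrature gives [t^2] the value 0, and all terms of that sum are nonnegative. *)
  have := wd (t * t); rewrite krylov_eq0M// => /esym/eqP.
  rewrite psumr_eq0 => [|i _]; last by rewrite hornerM mulr_ge0// -expr2 sqr_ge0.
  move=> /allP/(_ j); rewrite mem_index_enum => /(_ isT)/eqP.
  by rewrite hornerM mulrA => /eqP; rewrite mulf_eq0 => /orP[/eqP|/eqP->]; rewrite ?mulr0.
have dw j : w j != 0 -> 0 <= d j.
  move=> wj; rewrite leNgt; apply/negP => /t_neg tj.
  by have /eqP := wt j; rewrite mulf_eq0 (negPf wj) (negPf tj).
(* Nodes of weight 0 are unconstrained; taking absolute values makes them nonnegative too without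
   changing any sum. *)
have eqd j p : w j * p.[`|d j|] = w j * p.[d j].
  by have [->|/dw dj] := eqVneq (w j) 0; rewrite ?mul0r// ger0_norm.
exists w, (fun j => `|d j|); split=> // [j|p pn].
  by rewrite eqd.
by under eq_bigr do rewrite eqd; rewrite -wd truncated_moments.
Qed.

(** The last clause is Markov's inequality for [1/t], whose integral is the length of the truncated
    string. *)
Lemma fixed_end_quadrature n :
  exists w d : 'I_n.+1 -> R, [/\ forall j, 0 <= w j, forall j, 0 <= d j,
    forall p : {poly R}, (size p <= n.+1)%N -> \sum_j w j * p.[d j] = L p &
    forall e, 0 < e -> \sum_(j | d j <= e) w j <= e * \sum_(i < n.+1) l i].
Proof.
pose kap i := (l i)^-1; pose mu := truncate n (fun i => (m i)^-1).
have lk k : (k < n)%N -> l k * kap k = 1 by rewrite mulfV ?gt_eqF.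
have mk k : (k <= n)%N -> m k * mu k = 1.
  by move=> kn; rewrite /mu /truncate kn mulfV ?gt_eqF.
have Vf : forall k, krylov kap mu (f n.+1) k = 0.
  apply: (krylov_fixed_end m0 lk mk); first by rewrite mulfV ?gt_eqF.
  by rewrite /mu /truncate ltnn.
have f_neg x : x < 0 -> (f n.+1).[x] != 0.
  move=> x0; have [f1 _] := string_poly_ge1 m_gt0 l_gt0 m0 n.+1 (ltW x0).
  by rewrite gt_eqF// (lt_le_trans ltr01).
have [w [d [w0 d0 wf wd]]] := truncated_quadrature (fun i _ => erefl (kap i)) Vf f_neg.
exists w, d; split=> // e e0.
(* Since [f n.+1 = 1 - q X] vanishes at the nodes of nonzero weight, [q] takes there the value
   [1/t]. Its integral is the sum of the lengths because [L (h i) = 1]. *)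
pose q := \sum_(i < n.+1) l i *: h i.
have -> : \sum_(i < n.+1) l i = \sum_j w j * q.[d j].
  rewrite wd; last first.
    apply: (leq_trans (size_sum _ _ _)); apply/bigmax_leqP => i _.
    rewrite (leq_trans (size_scale_leq _ _))//.
    by rewrite (leq_trans (size_string_poly m l i).2).
  rewrite krylov_sum; apply: eq_bigr => i _; rewrite krylovZ.
  have lk' k : (k < n)%N -> l k * (l k)^-1 = 1 by rewrite mulfV ?gt_eqF.
  have mk' k : (k <= n)%N -> m k * (m k)^-1 = 1 by rewrite mulfV ?gt_eqF.
  have [_ ->] := krylov_string_poly_col m0 lk' mk' (ltn_ord i : (i <= n)%N).
  by rewrite mulr1.
have wq j : w j = w j * q.[d j] * d j.
  have := wf j; rewrite string_poly_sum !hornerE -/q => /eqP.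
  by rewrite mulrBr mulr1 subr_eq0 mulrA => /eqP.
rewrite mulr_sumr big_mkcond/=; apply: ler_sum => j _.
have wq0 : 0 <= w j * q.[d j].
  have [dj|dj] := ltP 0 (d j).
    by rewrite -(pmulr_lge0 _ dj) -wq.
  have dj0 : d j = 0 by apply/eqP; rewrite eq_le dj d0.
  by have := wq j; rewrite dj0 mulr0 => ->; rewrite mul0r.
case: ifPn => [dje|_]; last by rewrite mulr_ge0// ltW.
by rewrite {1}wq mulrC ler_wpM2r.
Qed.

(** At the positive nodes of nonzero weight [h n] vanishes, at 0 it equals the total mass, and its
    integral is 1; this determines the weight at 0. *)
Lemma free_end_quadrature n :
  exists w d : 'I_n.+1 -> R, [/\ forall j, 0 <= w j, forall j, 0 <= d j,
    forall p : {poly R}, (size p <= n.+1)%N -> \sum_j w j * p.[d j] = L p &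
    \sum_(j | d j <= 0) w j = (\sum_(i < n.+1) m i)^-1].
Proof.
pose kap i := if (i < n)%N then (l i)^-1 else 0.
pose mu := truncate n (fun i => (m i)^-1).
have lk k : (k < n)%N -> l k * kap k = 1 by move=> kn; rewrite /kap kn mulfV ?gt_eqF.
have mk k : (k <= n)%N -> m k * mu k = 1.
  by move=> kn; rewrite /mu /truncate kn mulfV ?gt_eqF.
have Vh : forall k, krylov kap mu (h n * 'X) k = 0.
  by apply: (krylov_free_end m0 lk mk); rewrite /kap ltnn.
have h_neg x : x < 0 -> (h n * 'X).[x] != 0.
  move=> x0; have [_ h1] := string_poly_ge1 m_gt0 l_gt0 m0 n (ltW x0).
  rewrite !hornerE; apply: mulf_neq0; last by rewrite lt_eqF.
  by rewrite gt_eqF// (lt_le_trans ltr01).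
have kapE i : (i < n)%N -> kap i = (l i)^-1 by rewrite /kap => ->.
have [w [d [w0 d0 wh wd]]] := truncated_quadrature kapE Vh h_neg.
exists w, d; split=> //.
have M0 : 0 < \sum_(i < n.+1) m i.
  by rewrite big_ord_recl ltr_wpDr// sumr_ge0// => i _; exact: ltW.
apply: (mulIf (lt0r_neq0 M0)); rewrite mulVf ?lt0r_neq0//.
have := wd (h n) (size_string_poly m l n).2.
have -> : L (h n) = 1.
  have lk' k : (k < n)%N -> l k * (l k)^-1 = 1 by rewrite mulfV ?gt_eqF.
  have mk' k : (k <= n)%N -> m k * (m k)^-1 = 1 by rewrite mulfV ?gt_eqF.
  by have [_ ->] := krylov_string_poly_col m0 lk' mk' (leqnn n).
move=> <-; rewrite mulr_suml big_mkcond/=; apply: eq_bigr => j _.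
have [dj|dj] := leP (d j) 0.
  have -> : d j = 0 by apply/eqP; rewrite eq_le dj d0.
  by rewrite (string_poly_at0 m l n).2.
have := wh j; rewrite !hornerE => /eqP; rewrite ?mulrA mulf_eq0 (gt_eqF dj) orbF.
by move=> /eqP.
Qed.

End TruncatedStrings.

(** * From the Jacobi matrix to the string operator *)

Section Jacobi.
Context {R : realType}.

(** Conjugation by the diagonal [D i = (-1)^i sqrt(m i)] carries one operator to the other; the
    alternating signs make the off-diagonal entries negative, and [D 0 = 1] preserves the first
    component. *)
Lemma moments_string (s m l : nat -> R) : associated_string s m l ->
  forall k, s k = krylov (fun i => (l i)^-1) (fun i => (m i)^-1) 'X^k 0%N.
Proof.
move=> [a [b [[a0 sE] [[m0 l0] m01 b0 bS aE]]]] k.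
set kap := fun i => (l i)^-1; set mu := fun i => (m i)^-1.
(* With the square roots as atoms [q i] and [m i = q i ^+ 2], the identities below are rational and
   fall to [field]. *)
have [q [q0 mE qE]] : exists q : nat -> R,
    [/\ forall i, q i != 0, forall i, m i = q i ^+ 2 &
        forall i, Num.sqrt (m i) = q i].
  exists (fun i => Num.sqrt (m i)); split=> // i; last by rewrite sqr_sqrtr ?ltW.
  by rewrite gt_eqF// sqrtr_gt0.
pose D i := (-1) ^+ i * q i.
have l_neq0 i : l i != 0 by rewrite gt_eqF.
have DE v n : jacobi_mul a b (fun i => D i * v i) n = D n * string_op kap mu v n.
  rewrite /jacobi_mul /string_op /D /kap /mu aE sqrtrM ?(ltW (m0 _))// !qE.
  case: n => [|n].
    rewrite b0 !mE; field.
    by rewrite l_neq0 !q0.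
  rewrite aE bS sqrtrM ?(ltW (m0 _))// !qE !mE !exprS; field.
  by rewrite !l_neq0 !q0.
rewrite krylovXn sE.
have -> : iter k (jacobi_mul a b) (e1 R) =
    fun i => D i * iter k (string_op kap mu) (e1 R) i.
  elim: k => [|k IH].
    apply/funext => -[|i]; rewrite /e1/= ?mulr0//.
    by rewrite /D -qE m01 sqrtr1 expr0 !mulr1.
  by apply/funext => i; rewrite iterS IH DE.
by rewrite /D -qE m01 sqrtr1 expr0 !mul1r.
Qed.

End Jacobi.

(** * Integration against a solution *)

Section Integration.
Context {R : realType}.
Variables (s : nat -> R) (rho : {measure set (measurableTypeR R) -> \bar R}).
Hypothesis sol : stieltjes_solution s rho.

Notation D := (`[0%R, +oo[%classic : set (measurableTypeR R)).

Lemma measurable_halfline : measurable D. Proof. exact: measurable_itv. Qed.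
Hint Resolve measurable_halfline : core.

Lemma measurable_horner (p : {poly R}) :
  measurable_fun D (fun x : measurableTypeR R => p.[x]).
Proof.
apply: (@measurable_funTS _ _ (measurableTypeR R) R).
apply: continuous_measurable_fun; exact: continuous_horner.
Qed.

Lemma integrable_monomial k : rho.-integrable D (fun x => (x ^+ k)%:E).
Proof.
apply/integrableP; split.
  apply/measurable_EFinP; have := measurable_horner 'X^k.
  by rewrite (_ : horner _ = fun x : R => x ^+ k)//; apply/funext => x; rewrite hornerXn.
have [_ /(_ k) sk] := sol.
have -> : (\int[rho]_(x in D) `|(x ^+ k)%:E| = \int[rho]_(x in D) (x ^+ k)%:E)%E.
  apply: eq_integral => x; rewrite inE/= in_itv/= andbT => x0.
  by rewrite /= ger0_norm// exprn_ge0.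
by rewrite sk ltry.
Qed.

Lemma solution_Rintegral_poly (p : {poly R}) :
  rho.-integrable D (fun x => (p.[x])%:E) /\
  \int[rho]_(x in D) p.[x] = \sum_(k < size p) p`_k * s k.
Proof.
have pE : (fun x : R => (p.[x])%:E) =
    (fun x => (\sum_(k < size p) (p`_k)%:E * (x ^+ k)%:E)%E).
  by apply/funext => x; rewrite horner_coef -sumEFin.
have ip : rho.-integrable D (fun x => (p.[x])%:E).
  rewrite pE; apply: integrable_sum => // k _.
  by apply: integrableZl => //; exact: integrable_monomial.
split=> //.
rewrite /Rintegral pE integral_sum//; last first.
  by move=> k; apply: integrableZl => //; exact: integrable_monomial.
under eq_bigr do
  rewrite integralZl ?(integrable_monomial)// (sol.2 _) -EFinM.
by rewrite sumEFin.
Qed.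

Lemma integrable_bounded (g : R -> R) (C : R) :
  measurable_fun D (g : measurableTypeR R -> R) ->
  (forall x, 0 <= x -> `|g x| <= C) ->
  rho.-integrable D (fun x => (g x)%:E).
Proof.
move=> mg gC.
apply: (@le_integrable _ (measurableTypeR R) R rho D measurable_halfline _
  (fun x => (C%:P.[x])%:E)).
- exact/measurable_EFinP.
- move=> x /=; rewrite in_itv/= andbT => x0.
  by rewrite hornerC lee_fin (le_trans (gC _ x0))// ler_norm.
- exact: (solution_Rintegral_poly _).1.
Qed.

Lemma solution_mass : rho D = (s 0%N)%:E.
Proof.
rewrite -(sol.2 0%N); under eq_integral do rewrite expr0.
by rewrite integral_cst// mul1e.
Qed.

Lemma solution_finite A : measurable A -> (rho (A `&` D) < +oo)%E.
Proof.
move=> mA; apply: (@le_lt_trans _ _ (rho D)); last by rewrite solution_mass ltry.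
by apply: le_measure; rewrite ?inE//; exact: measurableI.
Qed.

Lemma solution_tail (y : R) : 0 <= y ->
  rho.-integrable D (fun x => (\1_(`[y, +oo[%classic) x)%:E) /\
  (\int[rho]_(x in D) \1_(`[y, +oo[%classic) x)%:E = rho `[y, +oo[%classic.
Proof.
move=> y0; have my : measurable (`[y, +oo[%classic : set (measurableTypeR R)).
  exact: measurable_itv.
have yD : `[y, +oo[%classic `&` D = `[y, +oo[%classic :> set (measurableTypeR R).
  by apply/setIidl => x/=; rewrite !in_itv/= !andbT; exact: le_trans.
split.
  apply: (@integrable_bounded _ 1) => [|x _].
    by apply: measurable_funTS; exact: measurable_indic.
  by rewrite indicE ger0_norm// lern1 leq_b1.
rewrite /Rintegral fineK; first by rewrite integral_indic// yD.
by rewrite integral_indic// ge0_fin_numE ?solution_finite.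
Qed.

Lemma measurable_inv_shift x : 0 < x ->
  measurable_fun D (fun t : measurableTypeR R => (t + x)^-1).
Proof.
move=> x0.
apply: (@subspace_continuous_measurable_fun R D) => //.
apply/continuous_in_subspaceT => t; rewrite inE/= in_itv/= andbT => t0.
apply: cvgV; first by rewrite gt_eqF// ltr_wpDl.
by apply: cvgD; [exact: cvg_id|exact: cvg_cst].
Qed.

End Integration.

(** * Stieltjes transforms *)

Section Uniqueness.
Context {R : realType}.
Variable s : nat -> R.
Implicit Types rho : {measure set (measurableTypeR R) -> \bar R}.

Notation D := (`[0%R, +oo[%classic : set (measurableTypeR R)).
Notation I rho g := (Rintegral rho D (g : R -> R)).
Notation L p := (\sum_(k < size (p : {poly R})) (p : {poly R})`_k * s k).

Let mD : measurable D. Proof. exact: measurable_itv. Qed.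

Lemma halflineE (t : R) : D t = (0 <= t) :> Prop.
Proof. by rewrite /= in_itv/= andbT. Qed.

Lemma integrable_resolvent_pow rho n x : stieltjes_solution s rho -> 0 < x ->
  rho.-integrable D (fun t => ((t + x)^-1 ^+ n)%:E).
Proof.
move=> sol x0; apply: (@integrable_bounded _ _ _ sol _ (x^-1 ^+ n)).
  apply: (@measurable_funX _ (measurableTypeR R)).
  exact: measurable_inv_shift.
move=> t t0; have tx : 0 < t + x by rewrite ltr_wpDl.
rewrite ger0_norm ?exprn_ge0 ?invr_ge0 ?(ltW tx)//.
apply: lerXn2r; rewrite ?nnegrE ?invr_ge0 ?(ltW x0) ?(ltW tx)//.
by rewrite lef_pV2// lerDr.
Qed.

(* As [1 - c p] vanishes at [-x], [1/(t + x)] is a polynomial plus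
   [c p(t)/(t + x)]. *)
Lemma stieltjes_transform_split rho (p : {poly R}) (c x : R) :
  stieltjes_solution s rho -> 0 < x -> (forall t, 0 <= t -> 0 <= p.[t]) ->
  c * p.[- x] = 1 ->
  exists2 e, 0 <= e <= L p / x &
    I rho (fun t => (t + x)^-1) = L ((1 - c *: p) %/ ('X + x%:P)) + c * e.
Proof.
move=> sol x0 p0 cp.
set q := (1 - c *: p) %/ ('X + x%:P).
have qE : 1 - c *: p = q * ('X + x%:P).
  rewrite divpK// -[x%:P]opprK -polyCN dvdp_XsubCl.
  by rewrite /root !hornerE cp subrr.
have ptE t : 0 <= t -> c * (p.[t] / (t + x)) = (t + x)^-1 - q.[t].
  move=> t0; have tx : t + x != 0 by rewrite gt_eqF// ltr_wpDl.
  have := congr1 (horner^~ t) qE; rewrite !hornerE => E.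
  have -> : q.[t] = (1 - c * p.[t]) / (t + x) by rewrite E mulfK.
  by rewrite mulrBl mul1r opprB addrCA subrr addr0 ?mulrA.
have [ip Ip] := solution_Rintegral_poly sol p.
have [iq Iq] := solution_Rintegral_poly sol q.
have ir := integrable_resolvent_pow 1 sol x0.
(* Dividing [ptE] by [c] exhibits [p(t)/(t + x)] as a multiple of a difference of integrable
   functions. *)
have c0 : c != 0 by apply: contra_eq_neq cp => ->; rewrite mul0r eq_sym oner_eq0.
have irq : rho.-integrable D (fun t => ((t + x)^-1 - q.[t])%:E).
  exact: (integrableB mD ir iq).
have ie : rho.-integrable D (fun t => (p.[t] / (t + x))%:E).
  apply: (@eq_integrable _ _ _ _ _ mD
      (fun t => (c^-1%:E * ((t + x)^-1 - q.[t])%:E)%E)) => [t|].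
    by rewrite inE halflineE => t0; rewrite -ptE// -EFinM mulKf.
  exact: integrableZl.
exists (I rho (fun t => p.[t] / (t + x))).
  apply/andP; split.
    apply: Rintegral_ge0 => t; rewrite halflineE => t0.
    by rewrite divr_ge0 ?p0// addr_ge0// ltW.
  rewrite -Ip mulrC -RintegralZl//; apply: le_Rintegral => //.
    exact: (integrableZl mD x^-1 ip).
  move=> t; rewrite halflineE => t0; rewrite mulrC ler_wpM2r ?p0//.
  by rewrite lef_pV2 ?posrE ?ltr_wpDl// lerDr.
rewrite -Iq -RintegralZl// -RintegralD//; last first.
  exact: (integrableZl mD c ie).
by apply: eq_Rintegral => t; rewrite inE halflineE => t0; rewrite ptE// addrCA subrr addr0.
Qed.

Variables rho1 rho2 : {measure set (measurableTypeR R) -> \bar R}.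
Hypotheses (sol1 : stieltjes_solution s rho1) (sol2 : stieltjes_solution s rho2).

(** The polynomial part depends only on the moments and cancels; the two remainders lie in the same
    interval of length [L p / x], scaled by [c]. *)
Lemma eq_stieltjes_transform x : 0 < x ->
  (forall e, 0 < e -> exists (p : {poly R}) c,
    [/\ forall t, 0 <= t -> 0 <= p.[t], c * p.[- x] = 1 & `|c| * L p <= e]) ->
  I rho1 (fun t => (t + x)^-1) = I rho2 (fun t => (t + x)^-1).
Proof.
move=> x0 small; apply/eqP; rewrite -subr_eq0 -normr_le0; apply/ler_addgt0Pl => e e0.
have [p [c [p0 cp pe]]] := small _ (mulr_gt0 e0 x0).
have [e1 /andP[e1_ge0 e1p] ->] := stieltjes_transform_split sol1 x0 p0 cp.
have [e2 /andP[e2_ge0 e2p] ->] := stieltjes_transform_split sol2 x0 p0 cp.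
rewrite addr0 opprD addrACA subrr add0r -mulrBr normrM.
apply: (@le_trans _ _ (`|c| * (L p / x))).
  by apply: ler_wpM2l => //; rewrite ler_norml; apply/andP; split; lra.
by rewrite mulrA ler_pdivrMr.
Qed.

(** The mean value inequality for [(t + x)^-n] as a function of [x], obtained algebraically by
    induction on [n]. *)
Lemma resolvent_pow_diff (x y t : R) n : 0 < x -> x <= y -> 0 <= t ->
  n%:R * (y - x) * (t + y)^-1 ^+ n.+1 <= (t + x)^-1 ^+ n - (t + y)^-1 ^+ n
    <= n%:R * (y - x) * (t + x)^-1 ^+ n.+1.
Proof.
move=> x0 xy t0.
have tx : 0 < t + x by rewrite ltr_wpDl.
have ty : 0 < t + y by rewrite (lt_le_trans tx)// lerD2l.
set a := (t + x)^-1; set b := (t + y)^-1.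
have a0 : 0 <= a by rewrite invr_ge0 ltW.
have b0 : 0 <= b by rewrite invr_ge0 ltW.
have ba : b <= a by rewrite lef_pV2// lerD2l.
have abE : a - b = (y - x) * (a * b).
  by rewrite /a /b; field; rewrite !gt_eqF.
have yx : 0 <= y - x by rewrite subr_ge0.
elim: n => [|n /andP[IH1 IH2]]; first by rewrite !mul0r !expr0 subrr lexx.
have abn : b ^+ n <= a ^+ n by apply: lerXn2r; rewrite ?nnegrE.
have bn0 : 0 <= b ^+ n by rewrite exprn_ge0.
apply/andP; split.
  have -> : a ^+ n.+1 - b ^+ n.+1 = b * (a ^+ n - b ^+ n) + a ^+ n * (a - b).
    by rewrite !exprS; ring.
  apply: (@le_trans _ _ (b * (n%:R * (y - x) * b ^+ n.+1) + (y - x) * b ^+ n.+2)).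
    by rewrite -natr1 !exprS le_eqVlt; apply/orP; left; apply/eqP; ring.
  apply: lerD; first exact: ler_wpM2l.
  have -> : a ^+ n * (a - b) = (y - x) * (a * b * a ^+ n) by rewrite abE; ring.
  apply: ler_wpM2l => //; rewrite !exprS mulrA.
  by apply: ler_pM => //; rewrite ?mulr_ge0// ler_wpM2r.
have -> : a ^+ n.+1 - b ^+ n.+1 = a * (a ^+ n - b ^+ n) + b ^+ n * (a - b).
  by rewrite !exprS; ring.
apply: (@le_trans _ _ (a * (n%:R * (y - x) * a ^+ n.+1) + (y - x) * a ^+ n.+2)); last first.
  by rewrite -natr1 !exprS le_eqVlt; apply/orP; left; apply/eqP; ring.
apply: lerD; first exact: ler_wpM2l.
have -> : b ^+ n * (a - b) = (y - x) * (a * b * b ^+ n) by rewrite abE; ring.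
apply: ler_wpM2l => //; rewrite !exprS mulrA.
by apply: ler_pM => //; rewrite ?mulr_ge0// ler_wpM2l.
Qed.


(** The factor tends to 1 as [y] tends to [x], uniformly in [t]; this replaces continuity of the
    integral in the shift. *)
Lemma resolvent_pow_ratio (x y t : R) n : 0 < x -> x <= y -> 0 <= t ->
  (x / y) ^+ n * (t + x)^-1 ^+ n <= (t + y)^-1 ^+ n.
Proof.
move=> x0 xy t0; have y0 : 0 < y by exact: lt_le_trans xy.
rewrite -exprMn; apply: lerXn2r; rewrite ?nnegrE.
- by rewrite mulr_ge0 ?invr_ge0 ?addr_ge0 ?(ltW x0)// divr_ge0 ?ltW.
- by rewrite invr_ge0 addr_ge0 ?(ltW y0).
rewrite -subr_ge0.
have -> : (t + y)^-1 - x / y / (t + x) = t * (y - x) / (y * (t + x) * (t + y)).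
  by field; rewrite !gt_eqF// ltr_wpDl.
by rewrite divr_ge0 ?mulr_ge0 ?subr_ge0// ?addr_ge0// ltW.
Qed.

(** Both solutions give the same integral to the difference of the powers of exponent [n.+1]; by
    [resolvent_pow_diff] this value separates the two sides. *)
Lemma resolvent_pow_compare rho rho' (x y : R) n :
  stieltjes_solution s rho -> stieltjes_solution s rho' ->
  (forall z, 0 < z -> I rho (fun t => (t + z)^-1 ^+ n.+1) =
                      I rho' (fun t => (t + z)^-1 ^+ n.+1)) ->
  0 < x -> x < y ->
  I rho' (fun t => (t + y)^-1 ^+ n.+2) <= I rho (fun t => (t + x)^-1 ^+ n.+2).
Proof.
move=> sol sol' IH x0 xy; have y0 : 0 < y by exact: lt_trans xy.
have yx : 0 < n.+1%:R * (y - x) by rewrite mulr_gt0// subr_gt0.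
have ix k := integrable_resolvent_pow k sol x0.
have iy k := integrable_resolvent_pow k sol y0.
have ix' k := integrable_resolvent_pow k sol' x0.
have iy' k := integrable_resolvent_pow k sol' y0.
rewrite -(ler_pM2l yx) -(RintegralZl _ mD (iy' _)) -(RintegralZl _ mD (ix _)).
apply: (@le_trans _ _ (I rho' (fun t => (t + x)^-1 ^+ n.+1 - (t + y)^-1 ^+ n.+1))).
  apply: le_Rintegral => //.
  - exact: (integrableZl mD _ (iy' _)).
  - exact: (integrableB mD (ix' _) (iy' _)).
  move=> t; rewrite halflineE => t0.
  by have /andP[] := resolvent_pow_diff n.+1 x0 (ltW xy) t0.
have -> : I rho' (fun t => (t + x)^-1 ^+ n.+1 - (t + y)^-1 ^+ n.+1) =
    I rho (fun t => (t + x)^-1 ^+ n.+1 - (t + y)^-1 ^+ n.+1).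
  rewrite (RintegralB mD (ix' _) (iy' _)) (RintegralB mD (ix _) (iy _)).
  by congr (_ - _); apply/esym; exact: IH.
apply: le_Rintegral => //.
- exact: (integrableB mD (ix _) (iy _)).
- exact: (integrableZl mD _ (ix _)).
move=> t; rewrite halflineE => t0.
by have /andP[] := resolvent_pow_diff n.+1 x0 (ltW xy) t0.
Qed.

Lemma resolvent_pow_le rho rho' (x : R) n :
  stieltjes_solution s rho -> stieltjes_solution s rho' ->
  (forall z, 0 < z -> I rho (fun t => (t + z)^-1 ^+ n.+1) =
                      I rho' (fun t => (t + z)^-1 ^+ n.+1)) ->
  0 < x ->
  I rho' (fun t => (t + x)^-1 ^+ n.+2) <= I rho (fun t => (t + x)^-1 ^+ n.+2).
Proof.
move=> sol sol' IH x0.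
set J' := I rho' _; set J := I rho _.
have key y : x < y -> (x / y) ^+ n.+2 * J' <= J.
  move=> xy; apply: (le_trans _ (resolvent_pow_compare sol sol' IH x0 xy)).
  rewrite -RintegralZl//; last exact: integrable_resolvent_pow.
  apply: le_Rintegral => //.
  - exact: (integrableZl mD _ (integrable_resolvent_pow _ sol' x0)).
  - by apply: integrable_resolvent_pow => //; exact: lt_trans xy.
  by move=> t; rewrite halflineE => t0; apply: resolvent_pow_ratio => //; exact: ltW.
(* The shift [y] decreases to [x] along [x + 1/(k + 1)]. *)
have cvg1 : (x / (x + k.+1%:R^-1)) ^+ n.+2 * J' @[k --> \oo] --> (x / x) ^+ n.+2 * J'.
  apply: cvgM; last exact: cvg_cst.
  apply: (cvg_comp _ (fun z => z ^+ n.+2)); last exact: exprn_continuous.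
  apply: cvgM; first exact: cvg_cst.
  apply: cvgV; first by rewrite gt_eqF.
  rewrite -[X in _ --> X]addr0; apply: cvgD; first exact: cvg_cst.
  exact: cvg_harmonic.
rewrite divff ?gt_eqF// expr1n mul1r in cvg1.
apply: (ler_cvg_to cvg1 (cvg_cst J)); near=> k.
by apply: key; rewrite ltrDl invr_gt0.
Unshelve. all: by end_near. Qed.

End Uniqueness.

(** * Recovering the measure from its Stieltjes transform *)

Section Tails.
Context {R : realType}.
Variable s : nat -> R.
Variables rho1 rho2 : {measure set (measurableTypeR R) -> \bar R}.
Hypotheses (sol1 : stieltjes_solution s rho1) (sol2 : stieltjes_solution s rho2).

Notation D := (`[0%R, +oo[%classic : set (measurableTypeR R)).
Notation I rho g := (Rintegral rho D (g : R -> R)).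

Let mD : measurable D. Proof. exact: measurable_itv. Qed.

(** Each induction step amounts to differentiating in the shift [x]; exponent 0 is the total mass,
    given by the moments. *)
Lemma eq_resolvent_pow :
  (forall x, 0 < x -> I rho1 (fun t => (t + x)^-1) = I rho2 (fun t => (t + x)^-1)) ->
  forall n x, 0 < x ->
    I rho1 (fun t => (t + x)^-1 ^+ n) = I rho2 (fun t => (t + x)^-1 ^+ n).
Proof.
move=> H1 [x x0|].
  have [_ e1] := solution_Rintegral_poly sol1 1%:P.
  have [_ e2] := solution_Rintegral_poly sol2 1%:P.
  transitivity (I rho1 (fun t => (1%:P).[t])).
    by apply: eq_Rintegral => t _; rewrite hornerC.
  by rewrite e1 -e2; apply: eq_Rintegral => t _; rewrite hornerC expr0.
elim=> [//|n IH] x x0; apply/le_anti/andP; split.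
  by apply: (resolvent_pow_le sol2 sol1) => // z z0; rewrite IH.
exact: (resolvent_pow_le sol1 sol2).
Qed.

Lemma integrable_poly_resolvent rho (p : {poly R}) x :
  stieltjes_solution s rho -> 0 < x ->
  rho.-integrable D (fun t : R => (p.[x * (t + x)^-1])%:E) /\
  I rho (fun t => p.[x * (t + x)^-1]) =
  \sum_(k < size p) p`_k * x ^+ k * I rho (fun t => (t + x)^-1 ^+ k).
Proof.
move=> sol x0.
have pE : (fun t : R => (p.[x * (t + x)^-1])%:E) =
    (fun t => (\sum_(k < size p) (p`_k * x ^+ k)%:E * ((t + x)^-1 ^+ k)%:E)%E).
  apply/funext => t; rewrite horner_coef -sumEFin; apply: eq_bigr => k _.
  by rewrite exprMn mulrA.
have ik k : rho.-integrable D (fun t : R => ((p`_k * x ^+ k)%:E * ((t + x)^-1 ^+ k)%:E)%E).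
  exact: (integrableZl mD _ (integrable_resolvent_pow _ sol x0)).
split; first by rewrite pE; apply: integrable_sum.
rewrite /Rintegral pE integral_sum// (eq_bigr (fun k : 'I_(size p) =>
    (p`_k * x ^+ k * I rho (fun t => (t + x)^-1 ^+ k))%:E)) ?sumEFin// => k _.
have ir := integrable_resolvent_pow k sol x0.
by rewrite (integralZl mD ir) [in RHS]EFinM /Rintegral fineK//; exact: integrable_fin_num.
Qed.

Lemma onemX_ge (a : R) k : 0 <= a <= 1 -> 1 - k%:R * a <= (1 - a) ^+ k.
Proof.
move=> /andP[a0 a1]; elim: k => [|k IH]; first by rewrite mul0r subr0 expr0.
rewrite exprS -natr1; apply: (@le_trans _ _ ((1 - a) * (1 - k%:R * a))).
  rewrite -subr_ge0; have -> : (1 - a) * (1 - k%:R * a) - (1 - (k%:R + 1) * a)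
     = k%:R * (a * a) by ring.
  by rewrite !mulr_ge0.
by rewrite ler_wpM2l// subr_ge0.
Qed.

(** Combine [k a <= (1 + a)^k] with [(1 - a)(1 + a) <= 1]. *)
Lemma onemX_le (a : R) k : 0 <= a <= 1 -> (1 - a) ^+ k * (k%:R * a) <= 1.
Proof.
move=> /andP[a0 a1].
apply: (@le_trans _ _ ((1 - a) ^+ k * (1 + a) ^+ k)); last first.
  rewrite -exprMn -subr_sqr expr1n exprn_ile1// ?subr_ge0 ?exprn_ile1//.
  by rewrite lerBlDr lerDl exprn_ge0.
apply: ler_wpM2l; first by rewrite exprn_ge0// subr_ge0.
elim: k => [|k IH]; first by rewrite mul0r expr0.
rewrite exprS -natr1 mulrDl mul1r mulrDl mul1r lerD// ler_peMr//.
by rewrite exprn_ege1// lerDl.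
Qed.

(* With [u = x / (t + x)], [(1 - u^n)^(2^n)] tends to [1] for [t > x] and to
   [0] for [t < x]. *)
Lemma tail_le rho rho' (z x y : R) :
  stieltjes_solution s rho -> stieltjes_solution s rho' ->
  (forall n, I rho (fun t => (t + x)^-1 ^+ n) = I rho' (fun t => (t + x)^-1 ^+ n)) ->
  0 <= z -> z < x -> x < y ->
  (rho `[y, +oo[%classic <= rho' `[z, +oo[%classic)%E.
Proof.
move=> sol sol' eqI z0 zx xy.
have x0 : 0 < x by exact: le_lt_trans zx.
have y0 : 0 <= y by rewrite ltW// (lt_trans x0).
have [iy <-] := solution_tail sol y0.
have [iz <-] := solution_tail sol' z0.
rewrite lee_fin.
set Ty := Rintegral rho _ _; set Tz := Rintegral rho' _ _.
(* Here [u] is below 1/2 at [y] and above 1/2 at [z], so both rates are less than 1. The approximant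
   is at least [1 - al^n] for [t >= y] and at most [be^n] for [0 <= t < z]. *)
pose al := 2 * (x / (y + x)); pose be := (2 * (x / (z + x)))^-1.
have [yx0 zx0] : 0 < y + x /\ 0 < z + x by split; rewrite ltr_wpDl.
have al01 : 0 <= al < 1.
  apply/andP; split; first by rewrite mulr_ge0// divr_ge0 ?ltW.
  by rewrite /al mulrA ltr_pdivrMr//; lra.
have be01 : 0 < be < 1.
  have B1 : 1 < 2 * (x / (z + x)) by rewrite mulrA ltr_pdivlMr//; lra.
  have B0 : 0 < 2 * (x / (z + x)) by exact: lt_trans B1.
  by rewrite /be invr_gt0 B0 invf_lt1.
have be0 : be != 0 by have /andP[b0 _] := be01; rewrite gt_eqF.
have key n : (1 - al ^+ n) * Ty <= Tz + be ^+ n * s 0%N.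
  pose p : {poly R} := (1 - 'X^n) ^+ (2 ^ n).
  have [ip Ip] := integrable_poly_resolvent p sol x0.
  have [ip' Ip'] := integrable_poly_resolvent p sol' x0.
  have pE u : p.[u] = (1 - u ^+ n) ^+ (2 ^ n) by rewrite /p !hornerE.
  have u01 t : 0 <= t -> 0 <= x * (t + x)^-1 <= 1.
    move=> t0; have tx : 0 < t + x by rewrite ltr_wpDl.
    apply/andP; split; first by rewrite divr_ge0 ?(ltW x0) ?(ltW tx).
    by rewrite ler_pdivrMr// mul1r lerDr.
  have un01 t : 0 <= t -> 0 <= (x * (t + x)^-1) ^+ n <= 1.
    by move=> /u01 /andP[u0 u1]; rewrite exprn_ge0//= exprn_ile1.
  apply: (@le_trans _ _ (I rho (fun t => p.[x * (t + x)^-1]))).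
    rewrite -RintegralZl//; apply: le_Rintegral => //.
      exact: (integrableZl mD _ iy).
    move=> t; rewrite halflineE => t0; rewrite indicE pE.
    have /andP[un0 un1] := un01 _ t0.
    have [|_] := boolP (t \in _); last first.
      by rewrite mulr0 exprn_ge0// subr_ge0.
    rewrite inE/= in_itv/= andbT mulr1 => yt.
    apply: (le_trans _ (onemX_ge _ (un01 _ t0))).
    rewrite lerB// natrX -exprMn; apply: lerXn2r; rewrite ?nnegrE.
    - by rewrite mulr_ge0//; have /andP[] := u01 _ t0.
    - by case/andP: al01.
    rewrite ler_wpM2l// ler_wpM2l ?(ltW x0)// lef_pV2 ?posrE ?ltr_wpDl//.
    by rewrite lerD2r.
  have -> : I rho (fun t => p.[x * (t + x)^-1]) = I rho' (fun t => p.[x * (t + x)^-1]).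
    by rewrite Ip Ip'; apply: eq_bigr => k _; rewrite eqI.
  have [i1 e1] := solution_Rintegral_poly sol' (be ^+ n)%:P.
  have -> : be ^+ n * s 0%N = I rho' (fun t => ((be ^+ n)%:P).[t]).
    rewrite e1 size_polyC expf_neq0//=.
    by rewrite big_ord1 coefC.
  rewrite -RintegralD//; apply: le_Rintegral => //.
    exact: (integrableD mD iz i1).
  move=> t; rewrite halflineE => t0; rewrite indicE pE hornerC.
  have /andP[un0 un1] := un01 _ t0.
  have [_|] := boolP (t \in _).
    apply: (@le_trans _ _ 1); first by rewrite exprn_ile1 ?subr_ge0// lerBlDr lerDl.
    by rewrite lerDl exprn_ge0//; have /andP[/ltW] := be01.
  rewrite notin_setE/= in_itv/= andbT => /negP; rewrite -ltNge => tz.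
  rewrite add0r; have tx0 : 0 < t + x by rewrite ltr_wpDl.
  have := onemX_le (2 ^ n) (un01 _ t0).
  rewrite natrX -exprMn => H.
  have ut0 : 0 < (2 * (x * (t + x)^-1)) by rewrite mulr_gt0// divr_gt0.
  apply: (@le_trans _ _ ((2 * (x * (t + x)^-1)) ^+ n)^-1).
    by rewrite -[leRHS]div1r ler_pdivlMr// exprn_gt0.
  rewrite -exprVn; apply: lerXn2r; rewrite ?nnegrE.
  - by rewrite invr_ge0 ltW.
  - by have /andP[/ltW] := be01.
  rewrite lef_pV2 ?posrE ?mulr_gt0 ?invr_gt0//.
  rewrite ler_wpM2l// ler_wpM2l ?(ltW x0)// lef_pV2 ?posrE//.
  by rewrite lerD2r ltW.
have cvg0 a : 0 <= a < 1 -> a ^+ n @[n --> \oo] --> (0 : R).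
  by move=> /andP[a0 a1]; apply: cvg_expr; rewrite ger0_norm.
have c1 : (1 - al ^+ n) * Ty @[n --> \oo] --> (1 - 0) * Ty.
  by apply: cvgM; [apply: cvgB; [exact: cvg_cst|exact: cvg0]|exact: cvg_cst].
have c2 : Tz + be ^+ n * s 0%N @[n --> \oo] --> Tz + 0 * s 0%N.
  apply: cvgD; [exact: cvg_cst|apply: cvgM; [apply: cvg0|exact: cvg_cst]].
  by have /andP[/ltW -> ->] := be01.
rewrite subr0 mul1r in c1; rewrite mul0r addr0 in c2.
by apply: (ler_cvg_to c1 c2); near=> n; exact: key.
Unshelve. all: by end_near. Qed.

Hypothesis eqI : forall x, 0 < x ->
  I rho1 (fun t => (t + x)^-1) = I rho2 (fun t => (t + x)^-1).

Lemma tail_le_same rho rho' (y : R) :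
  stieltjes_solution s rho -> stieltjes_solution s rho' ->
  (forall n x, 0 < x ->
    I rho (fun t => (t + x)^-1 ^+ n) = I rho' (fun t => (t + x)^-1 ^+ n)) ->
  0 < y -> (rho `[y, +oo[%classic <= rho' `[y, +oo[%classic)%E.
Proof.
move=> sol sol' eqP y0.
(* The sequence starts at 0 and increases to [y], so [tail_le] applies at each [z k] and continuity
   from above gives the limit. *)
pose z k : R := y - y / k.+1%:R.
have zy k : 0 <= z k < y.
  have k2 : y / k.+1%:R <= y.
    by rewrite ler_pdivrMr// ler_peMr ?(ltW y0)// ler1n.
  by rewrite /z subr_ge0 k2 ltrBlDr ltrDl divr_gt0.
have capE : \bigcap_k `[z k, +oo[%classic = `[y, +oo[%classic
    :> set (measurableTypeR R).
  apply/seteqP; split=> [t tz|t] /=.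
    rewrite in_itv/= andbT.
    have zc : z k @[k --> \oo] --> y - y * 0.
      apply: cvgB; first exact: cvg_cst.
      apply: cvgM; first exact: cvg_cst.
      exact: cvg_harmonic.
    rewrite mulr0 subr0 in zc.
    apply: (ler_cvg_to zc (cvg_cst t)); near=> k.
    by have := tz k Logic.I; rewrite /= in_itv/= andbT.
  rewrite in_itv/= andbT => yt k _; rewrite /= in_itv/= andbT.
  by have /andP[_ /ltW zk] := zy k; exact: le_trans yt.
have cvgz : rho' `[z k, +oo[%classic @[k --> \oo] --> rho' `[y, +oo[%classic.
  rewrite -capE; apply: nonincreasing_cvg_mu.
  - have /andP[z0 _] := zy 0%N.
    by have [_ <-] := solution_tail sol' z0; rewrite ltry.
  - by move=> k; exact: measurable_itv.
  - by apply: bigcapT_measurable => k; exact: measurable_itv.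
  move=> i j ij; apply/subsetPset => t /=; rewrite !in_itv/= !andbT.
  apply: le_trans; rewrite lerB// ler_wpM2l ?(ltW y0)//.
  by rewrite lef_pV2 ?posrE// ler_nat.
apply: (lee_cvg_to (cvg_cst _) cvgz); near=> k.
have /andP[z0 zky] := zy k.
pose x := (z k + y) / 2.
by apply: (@tail_le rho rho' (z k) x y) => //; rewrite /x; [move=> n; apply: eqP|..]; lra.
Unshelve. all: by end_near. Qed.

(** The closed right half-lines are stable under intersection and generate the Borel sets. Those
    starting at or below 0 carry the full mass [s 0]. *)
Lemma stieltjes_solution_unique (A : set (measurableTypeR R)) :
  measurable A -> rho1 A = rho2 A.
Proof.
have null rho y : stieltjes_solution s rho -> y <= 0 ->
    rho `[y, +oo[%classic = (s 0%N)%:E.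
  move=> sol y0; have mA : measurable (`[y, +oo[%classic : set (measurableTypeR R)).
    exact: measurable_itv.
  rewrite (measureDI rho mA mD) [X in (X + _)%E](_ : _ = 0%E) ?add0e.
    rewrite setIidr; first exact: (solution_mass sol).
    by move=> t /=; rewrite !in_itv/= !andbT; exact: le_trans.
  apply: (@subset_measure0 _ _ _ rho _ (~` D)); last exact: sol.1.
  - exact: measurableD.
  - exact: measurableC.
  - by move=> t [].
have tails y : rho1 `[y, +oo[%classic = rho2 `[y, +oo[%classic.
  have [y0|y0] := ltP 0 y.
    apply/le_anti/andP; split; apply: tail_le_same => // n x x0.
      exact: eq_resolvent_pow.
    by apply/esym; exact: eq_resolvent_pow.
  by rewrite !null.
apply: (@measure_unique _ R (measurableTypeR R) (@RGenCInfty.G R)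
  (fun k => `[- k%:R, +oo[%classic)).
- exact: RGenCInfty.measurableE.
- move=> _ _ [x ->] [y ->]; exists (Num.max x y).
  by apply/seteqP; split=> t/=; rewrite !in_itv/= !andbT ge_max => /andP.
- by move=> k; exists (- k%:R).
- rewrite -subTset => t _; exists (Num.truncn `|t|).+1 => //=.
  rewrite in_itv/= andbT lerNl (le_trans (ler_norm _))// normrN.
  by rewrite ltW// truncnS_gt.
- by move=> _ [y ->]; exact: tails.
- move=> k; have k0 : - k%:R <= 0 :> R by rewrite oppr_le0.
  by rewrite (null _ _ sol1) ?ltry.
Qed.

End Tails.

(** * Compactness *)

Section Helly.
Context {R : realType}.

(** The image of [U] clusters in the compact segment, and a cluster point of an ultrafilter is a
    limit. *)
Lemma ultra_bounded_cvg (U : set_system nat) (u : nat -> R) (a b : R) :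
  UltraFilter U -> (forall n, a <= u n <= b) -> exists p : R, u @ U --> p.
Proof.
move=> FU uab; have PU : ProperFilter U by exact: ultra_proper.
have [|p [_ clp]] := @segment_compact R a b _ (fmap_proper_filter u PU).
  by apply: (@filterE _ U) => n /=; rewrite in_itv/=; exact: uab.
exists p => V Vp; have [//|nV] := in_ultra_setVsetC (u @^-1` V) FU.
by have [y [nVy Vy]] := clp (~` V) V nV Vp.
Qed.

Section DistributionFunction.
Variables (F : R -> R) (c : R).
Hypothesis F_nd : forall x y, x <= y -> F x <= F y.
Hypothesis F_neg : forall x, x < 0 -> F x = 0.
Hypothesis F_le1 : forall x, F x <= 1.
Hypothesis F_tail : forall x, 0 < x -> 1 - c / x <= F x.

(** A pointwise limit of distribution functions may fail to be right-continuous; this is its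
    right-continuous regularization. Hence the strict [x < y] in the upper bounds that follow. *)
Definition right_limit (x : R) : R := inf [set F y | y in [set y | x < y]].

Let F_ge0 x : 0 <= F x.
Proof.
have [x0|x0] := ltP x 0; first by rewrite F_neg.
by rewrite -(F_neg (ltrN10 R)) F_nd// (le_trans _ x0)// lerN10.
Qed.

Let has_inf_right x : has_inf [set F y | y in [set y | x < y]].
Proof.
split; first by exists (F (x + 1)), (x + 1) => //=; rewrite ltrDl.
by exists 0 => _ [y _ <-].
Qed.

Lemma right_limit_ge x : F x <= right_limit x.
Proof.
apply: lb_le_inf; first exact: (has_inf_right x).1.
by move=> _ [y /= xy <-]; exact: F_nd (ltW xy).
Qed.

Lemma right_limit_le x y : x < y -> right_limit x <= F y.
Proof. by move=> xy; apply: ge_inf; [exact: (has_inf_right x).2|exists y]. Qed.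

Let right_limit_nd : nondecreasing right_limit.
Proof.
move=> x y xy; apply: lb_le_inf; first exact: (has_inf_right y).1.
by move=> _ [z /= yz <-]; apply: right_limit_le; exact: le_lt_trans yz.
Qed.

Let right_limit_rc : right_continuous right_limit.
Proof.
move=> x; apply/cvgrPdist_le => e e0.
have [_ [y /= xy <-] ye] := inf_adherent e0 (has_inf_right x).
near=> z; have xz : x < z by [].
have zy : z < y by near: z; exact: nbhs_right_lt.
rewrite ler0_norm ?subr_le0; last exact: right_limit_nd (ltW xz).
by rewrite opprB lerBlDl (le_trans (right_limit_le zy))// ltW.
Unshelve. all: by end_near. Qed.

#[local] HB.instance Definition _ :=
  isCumulative.Build R _ R right_limit right_limit_nd right_limit_rc.

Let right_limit_Ny : right_limit @ -oo --> (0 : R).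
Proof.
apply: cvg_near_cst; near=> x; apply/eqP; rewrite eq_le; apply/andP; split.
  have x1 : x < -1 by near: x; exact: nbhs_ninfty_lt.
  by rewrite (le_trans (right_limit_le x1))// F_neg// ltrN10.
by rewrite (le_trans _ (right_limit_ge x)).
Unshelve. all: by end_near. Qed.

Let right_limit_y : right_limit @ +oo --> (1 : R).
Proof.
apply: (@squeeze_cvgr _ _ _ _ (fun x => 1 - c / x) (cst 1)).
- near=> x; have x0 : 0 < x by near: x; exact: nbhs_pinfty_gt.
  rewrite (le_trans (F_tail x0) (right_limit_ge x))/=.
  by rewrite (le_trans (right_limit_le (_ : x < x + 1))) ?ltrDl.
- rewrite -[X in _ --> X]subr0; apply: cvgB; first exact: cvg_cst.
  rewrite -(mulr0 c); apply: cvgM; first exact: cvg_cst.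
  apply/gtr0_cvgV0; last exact: cvg_id.
  by near=> x; near: x; exact: nbhs_pinfty_gt.
- exact: cvg_cst.
Unshelve. all: by end_near. Qed.

#[local] HB.instance Definition _ :=
  isCumulativeBounded.Build R 0 1 right_limit right_limit_Ny right_limit_y.

Lemma distribution_function_measure :
  exists mu : probability (measurableTypeR R) R,
    (forall x, ((F x)%:E <= mu `]-oo, x]%classic)%E) /\
    (forall x y, x < y -> (mu `]-oo, x]%classic <= (F y)%:E)%E).
Proof.
pose mu : probability (measurableTypeR R) R :=
  lebesgue_stieltjes_measure right_limit.
have muE x : mu `]-oo, x]%classic = (right_limit x)%:E.
  exact: (cdf_lebesgue_stieltjes_id (right_limit : cumulativeBounded 0 1) x).
exists mu; split.
- by move=> x; rewrite muE lee_fin right_limit_ge.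
- by move=> x y xy; rewrite muE lee_fin right_limit_le.
Qed.

End DistributionFunction.

End Helly.

(** * Passing moments to the limit *)

Section HellyMoments.
Context {R : realType}.

(* Lower staircase approximation of [min(a, n c)] with steps of height [c]. *)
Definition staircase (c : R) (n : nat) (a : R) : R :=
  \sum_(i < n) c * (i.+1%:R * c < a)%R%:R.

Lemma staircase_le c n a : 0 < c -> 0 <= a -> staircase c n a <= a.
Proof.
move=> c0 a0; suff : staircase c n a <= Num.min a (n%:R * c).
  by rewrite le_min => /andP[].
elim: n => [|n IH]; first by rewrite /staircase big_ord0 mul0r le_min a0 lexx.
rewrite /staircase big_ord_recr/= -/(staircase c n a) le_min.
move: IH; rewrite le_min => /andP[IHa IHn].
have [ca|ca] := ltP (n.+1%:R * c) a; last first.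
  by rewrite mulr0 addr0 IHa/= (le_trans IHn)// ler_wpM2r ?(ltW c0)// ler_nat.
have E : staircase c n a + c * 1 <= n.+1%:R * c.
  by rewrite mulr1 -natr1 mulrDl mul1r lerD2r.
by rewrite E andbT (le_trans E)// ltW.
Qed.

(** The last step not reached by [a] is the only loss, hence an error of at most [c]. *)
Lemma staircase_ge c n a : 0 < c -> 0 <= a ->
  Num.min a (n%:R * c) - c <= staircase c n a.
Proof.
move=> c0 a0.
have full k : k%:R * c < a -> staircase c k a = k%:R * c.
  move=> ka; rewrite /staircase (eq_bigr (fun=> c)) => [|i _].
    by rewrite big_const_ord iter_addr_0 mulr_natl.
  rewrite (_ : (_ < a) = true) ?mulr1//; apply: le_lt_trans ka.
  by rewrite ler_wpM2r ?(ltW c0)// ler_nat.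
elim: n => [|n IH].
  rewrite /staircase big_ord0 mul0r min_r// sub0r oppr_le0; exact: ltW.
have [ca|ca] := ltP (n.+1%:R * c) a.
  by rewrite full// gerBl ltW.
rewrite /staircase big_ord_recr/= -/(staircase c n a).
rewrite (_ : (_ < a) = false) ?mulr0 ?addr0; last by apply/negbTE; rewrite -leNgt.
have [na|na] := ltP (n%:R * c) a.
  by rewrite full// lerBlDr -[X in _ + X]mul1r -mulrDl natr1.
by move: IH; rewrite min_l.
Qed.

Variables (s : nat -> R) (w d : forall N, 'I_N.+1 -> R).
Hypothesis s0 : s 0%N = 1.
Hypothesis w_ge0 : forall N j, 0 <= w (N := N) j.
Hypothesis d_ge0 : forall N j, 0 <= d (N := N) j.
Hypothesis w_moment : forall N k, (k <= N)%N ->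
  \sum_j w (N := N) j * d (N := N) j ^+ k = s k.

Notation D := (`[0%R, +oo[%classic : set (measurableTypeR R)).
Notation FN N x := (\sum_(j | d (N := N) j <= x) w (N := N) j).

Let w_sum N : \sum_j w (N := N) j = 1.
Proof.
by rewrite -s0 -(w_moment (leq0n N)); apply: eq_bigr => j _; rewrite expr0 mulr1.
Qed.

Let FN_nd N x y : x <= y -> FN N x <= FN N y.
Proof.
move=> xy; rewrite [leRHS](bigID (fun j => d j <= x))/=.
rewrite [X in _ <= X + _](eq_bigl (fun j => d (N := N) j <= x)) => [|j].
  by rewrite lerDl sumr_ge0.
by rewrite andb_idl// => /le_trans; exact.
Qed.

Let FN_01 N x : 0 <= FN N x <= 1.
Proof.
apply/andP; split; first by rewrite sumr_ge0.
rewrite -(w_sum N) [leRHS](bigID (fun j => d (N := N) j <= x))/=.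
by rewrite lerDl sumr_ge0.
Qed.

Let FN_compl N x : 1 - FN N x = \sum_j w (N := N) j * (x < d (N := N) j)%R%:R.
Proof.
rewrite -[X in X - _](w_sum N) (bigID (fun j => d (N := N) j <= x))/=.
rewrite [X in X - _]addrC addrK.
rewrite big_mkcond; apply: eq_bigr => j _.
by rewrite ltNge; case: ifP => _; rewrite ?mulr1 ?mulr0.
Qed.

(** One ultrafilter gives limits at all real [x] simultaneously, in place of a diagonal
    extraction. *)
Lemma helly_distribution :
  exists (U : set_system nat) (F : R -> R), [/\ UltraFilter U, \oo `<=` U,
    forall x, FN N x @[N --> U] --> F x & forall x y, x <= y -> F x <= F y].
Proof.
have [U [UU oU]] := ultraFilterLemma (eventually_filter).
have PU : ProperFilter U by exact: ultra_proper.
have /choice [F FU] : forall x, exists p : R, FN N x @[N --> U] --> p.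
  by move=> x; apply: (ultra_bounded_cvg UU) => N; exact: FN_01.
exists U, F; split=> // x y xy.
by apply: (ler_cvg_to (FU x) (FU y)); apply: filterE => N; exact: FN_nd.
Qed.

(** The integral of a staircase in [x^(k+1)] is a finite combination of tail masses, so it passes to
    the limit; the moment of order [2(k+1)] bounds what the staircase cuts off. *)
Lemma helly_moments :
  exists mu : {measure set (measurableTypeR R) -> \bar R},
    [/\ stieltjes_solution s mu,
        forall x c, (forall N, c <= FN N x) -> (c%:E <= mu `]-oo, x]%classic)%E &
        forall x y c, x < y -> (forall N, FN N y <= c) ->
          (mu `]-oo, x]%classic <= c%:E)%E].
Proof.
have [U [F [UU oU FU F_nd]]] := helly_distribution.
have PU : ProperFilter U by exact: ultra_proper.
have F_ge x c : (forall N, c <= FN N x) -> c <= F x.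
  move=> cF; apply: (ler_cvg_to (@cvg_cst _ c _ U _) (FU x)).
  by apply: filterE => N; exact: cF.
have F_le x c : (forall N, FN N x <= c) -> F x <= c.
  move=> cF; apply: (ler_cvg_to (FU x) (@cvg_cst _ c _ U _)).
  by apply: filterE => N; exact: cF.
have F_neg x : x < 0 -> F x = 0.
  move=> x0.
  have FN0 N : FN N x = 0.
    by rewrite big_pred0// => j; rewrite leNgt (lt_le_trans x0).
  by apply/le_anti/andP; split; [apply: F_le|apply: F_ge] => N; rewrite FN0.
have F_le1 x : F x <= 1 by apply: F_le => N; case/andP: (FN_01 N x).
(* Tightness, by Markov's inequality with the first moment. *)
have F_tail x : 0 < x -> 1 - s 1%N / x <= F x.
  move=> x0; apply: (ler_cvg_to (@cvg_cst _ _ _ U _) (FU x)).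
  apply: oU; exists 1%N => // N /= N1.
  rewrite lerBlDr -lerBlDl FN_compl ler_pdivlMr// mulr_suml -(w_moment N1).
  apply: ler_sum => j _; rewrite expr1 -mulrA ler_wpM2l//.
  by case: ltP => xd; rewrite ?mul1r ?mul0r// ltW.
have [mu [mu_ge mu_le]] := distribution_function_measure F_nd F_neg F_le1 F_tail.
exists mu; split; last 2 first.
- by move=> x c cF; apply: le_trans (mu_ge x); rewrite lee_fin F_ge.
- by move=> x y c xy cF; apply: (le_trans (mu_le _ _ xy)); rewrite lee_fin F_le.
have mD : measurable D by exact: measurable_itv.
have mTail t : measurable (`]t, +oo[%classic : set (measurableTypeR R)).
  exact: measurable_itv.
have mI t : measurable (`]-oo, t]%classic : set (measurableTypeR R)).
  exact: measurable_itv.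
have tailE t : mu `]t, +oo[%classic = (1 - mu `]-oo, t]%classic)%E.
  by rewrite -setCitvl probability_setC.
have tail_le t : (mu `]t, +oo[%classic <= (1 - F t)%:E)%E.
  by rewrite tailE EFinB leeB.
have tail_ge x y : x < y -> ((1 - F y)%:E <= mu `]x, +oo[%classic)%E.
  by move=> xy; rewrite tailE EFinB leeB// mu_le.
have mD1 : mu D = 1%E.
  apply/le_anti; rewrite probability_le1//=.
  pose z k : R := - k.+1%:R^-1.
  have z0 k : z k < 0 by rewrite oppr_lt0 invr_gt0.
  have capE : \bigcap_k `]z k, +oo[%classic = D.
    apply/seteqP; split=> [t tz|t] /=.
      rewrite in_itv/= andbT.
      have zc : z k @[k --> \oo] --> - (0 : R) by apply: cvgN; exact: cvg_harmonic.
      rewrite oppr0 in zc.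
      apply: (ler_cvg_to zc (cvg_cst t)); near=> k.
      by have := tz k Logic.I; rewrite /= in_itv/= andbT => /ltW.
    rewrite in_itv/= andbT => t0 k _; rewrite /= in_itv/= andbT.
    exact: lt_le_trans (z0 k) t0.
  have cvgz : mu `]z k, +oo[%classic @[k --> \oo] --> mu D.
    rewrite -capE; apply: nonincreasing_cvg_mu => //.
    - by rewrite (le_lt_trans (probability_le1 _ _))// ltry.
    - by apply: bigcapT_measurable => k.
    move=> i j ij; apply/subsetPset => t /=; rewrite !in_itv/= !andbT.
    by apply: le_lt_trans; rewrite lerN2 lef_pV2 ?posrE// ler_nat.
  apply: (lee_cvg_to (cvg_cst 1%E) cvgz); near=> k.
  have := @tail_ge (z k) (z k / 2).
  rewrite F_neg ?subr0; last by rewrite ltr_pdivrMr// mul0r.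
  by apply; have := z0 k; lra.
have null : mu (~` `[0%R, +oo[%classic) = 0%E.
  by rewrite probability_setC// mD1 subee.
split=> // -[|k].
  under eq_integral do rewrite expr0.
  rewrite integral_cst// mul1e s0; exact: mD1.
pose tau t := fine (mu `]t, +oo[%classic).
have tauE t : mu `]t, +oo[%classic = (tau t)%:E.
  by rewrite fineK// fin_num_measure.
pose step (t : nat -> R) (c : R) n (x : measurableTypeR R) : R :=
  \sum_(i < n) c * \1_(`]t i.+1, +oo[%classic) x.
have mstep t c n : measurable_fun D (step t c n).
  apply: measurable_sum => i; apply: measurable_funM; first exact: measurable_cst.
  by apply: measurable_funTS; exact: measurable_indic.
have step_ge0 t c n x : 0 < c -> 0 <= step t c n x.
  by move=> c0; apply: sumr_ge0 => i _; rewrite mulr_ge0// ltW.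
have step_int t c n : 0 < c -> (forall i, 0 <= t i) ->
    (\int[mu]_(x in D) (step t c n x)%:E = (\sum_(i < n) c * tau (t i.+1))%:E)%E.
  move=> c0 t0; under eq_integral do rewrite -sumEFin.
  rewrite ge0_integral_sum//=; first last.
  - by move=> i x _; rewrite lee_fin mulr_ge0// ltW.
  - move=> i; apply/measurable_EFinP.
    apply: measurable_funM; first exact: measurable_cst.
    by apply: measurable_funTS; exact: measurable_indic.
  rewrite -sumEFin; apply: eq_bigr => i _.
  under eq_integral do rewrite EFinM.
  rewrite ge0_integralZl_EFin ?ltW//; first last.
  - apply/measurable_EFinP.
    by apply: measurable_funTS; exact: measurable_indic.
  rewrite integral_indic// setIidl; first by rewrite EFinM -tauE.
  by move=> x /=; rewrite !in_itv/= !andbT => /ltW; exact: le_trans.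
have main c n : 0 < c -> exists J : R, exists t : nat -> R,
  [/\ (\int[mu]_(x in D) (step t c n x)%:E = J%:E)%E,
      forall x, 0 <= x -> step t c n x = staircase c n (x ^+ k.+1),
      J <= s k.+1 &
      (0 < n)%N -> s k.+1 - s (k.+1 * 2)%N / (n%:R * c) - c <= c + J].
  move=> c0.
  (* The thresholds are the points where [x^(k+1)] reaches the levels [i c]. *)
  pose t i := (i%:R * c) `^ (k.+1%:R^-1).
  have t0 i : 0 <= t i by exact: powR_ge0.
  have tE i : t i ^+ k.+1 = i%:R * c.
    rewrite -powR_mulrn// -powRrM mulVf// powRr1//.
    by rewrite mulr_ge0// ltW.
  have t_lt x i : 0 <= x -> (t i < x) = (i%:R * c < x ^+ k.+1).
    by move=> x0; rewrite -tE ltr_pXn2r ?nnegrE.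
  have stepE x : 0 <= x -> step t c n x = staircase c n (x ^+ k.+1).
    move=> x0; apply: eq_bigr => i _; rewrite -t_lt// indicE.
    by congr (_ * _%:R); rewrite mem_setE in_itv/= andbT.
  pose A := \sum_(i < n) c * (1 - F (t i.+1)).
  pose AN N := \sum_(i < n) c * (1 - FN N (t i.+1)).
  have ANc : AN N @[N --> U] --> A.
    apply: cvg_big => [|i _]; first exact: add_continuous.
    by apply: cvgM; [exact: cvg_cst|apply: cvgB => //; exact: cvg_cst].
  have ANE N : AN N = \sum_j w (N := N) j * staircase c n (d (N := N) j ^+ k.+1).
    rewrite /AN; under eq_bigr do rewrite FN_compl mulr_sumr.
    rewrite exchange_big/=; apply: eq_bigr => j _.
    by rewrite mulr_sumr; apply: eq_bigr => i _; rewrite t_lt// mulrCA.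
  have A_le : A <= s k.+1.
    apply: (ler_cvg_to ANc (@cvg_cst _ _ _ U _)); apply: oU; exists k.+1 => // N /= kN.
    rewrite ANE -(w_moment kN); apply: ler_sum => j _.
    by rewrite ler_wpM2l// staircase_le// exprn_ge0.
  (* This rests on [a - a^2 / K <= min(a, K)] at each node, where [K = n c]; the constant [c] is
     spread over weights of sum 1. *)
  have A_ge : (0 < n)%N -> s k.+1 - s (k.+1 * 2)%N / (n%:R * c) - c <= A.
    move=> n0; apply: (ler_cvg_to (@cvg_cst _ _ _ U _) ANc).
    apply: oU; exists (k.+1 * 2)%N => // N /= kN.
    have : 0 < n%:R * c by rewrite mulr_gt0// ltr0n.
    set K := n%:R * c => K0.
    rewrite ANE -(w_moment kN) -(@w_moment N k.+1); last by lia.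
    rewrite -[X in _ - X <= _]mulr1 -(w_sum N) mulr_suml mulr_sumr -!sumrB.
    apply: ler_sum => j _; set a := d j ^+ k.+1.
    have a0 : 0 <= a by rewrite exprn_ge0.
    rewrite exprM -/a -mulrA (mulrC c) -!mulrBr ler_wpM2l//.
    apply: le_trans (staircase_ge n c0 a0); rewrite lerB// le_min.
    rewrite gerBl divr_ge0 ?sqr_ge0 ?(ltW K0)//=.
    rewrite lerBlDr -subr_ge0.
    have -> : K + a ^+ 2 / K - a = ((K - a / 2) ^+ 2 + 3 / 4 * a ^+ 2) / K.
      by field; rewrite gt_eqF.
    rewrite divr_ge0 ?(ltW K0)// addr_ge0 ?sqr_ge0// mulr_ge0 ?sqr_ge0//; lra.
  exists (\sum_(i < n) c * tau (t i.+1)), t; split=> //.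
  - by rewrite step_int.
  - apply: le_trans A_le; apply: ler_sum => i _; rewrite ler_wpM2l ?(ltW c0)//.
    by rewrite -lee_fin -tauE.
  move=> n0; apply: (le_trans (A_ge n0)).
  have tau_ge0 x : 0 <= tau x by rewrite fine_ge0.
  (* The limit [F] bounds tails of [mu] from below only at a strictly smaller threshold. Shifting
     the index by one brings in [tau (t 0) <= 1], at a cost of at most [c]. *)
  apply: (@le_trans _ _ (\sum_(i < n) c * tau (t i))).
    apply: ler_sum => i _; rewrite ler_wpM2l ?(ltW c0)//.
    rewrite -lee_fin -tauE; apply: tail_ge.
    by rewrite t_lt// tE ltr_pM2r// ltr_nat.
  have : \sum_(i < n.+1) c * tau (t i) = \sum_(i < n.+1) c * tau (t i) by [].
  rewrite {1}big_ord_recr big_ord_recl/= => E.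
  have t01 : tau (t 0%N) <= 1 by rewrite -lee_fin -tauE probability_le1.
  have ct : c * tau (t 0%N) <= c by rewrite ler_piMr// ltW.
  have cn : 0 <= c * tau (t n) by rewrite mulr_ge0// ltW.
  rewrite -(lerD2r (c * tau (t n))) E.
  by apply: (le_trans (lerD ct (lexx _))); rewrite lerDl.
have mX : measurable_fun D (fun x : measurableTypeR R => ((x : R) ^+ k.+1)%:E).
  apply/measurable_EFinP; have := measurable_horner ('X^(k.+1) : {poly R}).
  by rewrite (_ : horner _ = fun x : R => x ^+ k.+1)//; apply/funext => x;
    rewrite hornerXn.
pose g (p : nat) (x : measurableTypeR R) : \bar R :=
  (Num.min ((x : R) ^+ k.+1) p.+1%:R)%:E.
have mg p : measurable_fun D (g p).
  apply/measurable_EFinP; apply: measurable_minr; last exact: measurable_cst.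
  exact/measurable_EFinP.
have g_ge0 p x : D x -> (0 <= g p x)%E.
  by rewrite /= in_itv/= andbT => x0; rewrite lee_fin le_min exprn_ge0/=.
have g_le p : (\int[mu]_(x in D) g p x <= (s k.+1 + p.+1%:R^-1)%:E)%E.
  have p0 : 0 < p.+1%:R^-1 :> R by rewrite invr_gt0.
  (* Steps of height [1/(p + 1)], in number [(p + 1)^2], reach the truncation level [p + 1]. *)
  have [J [t [JE stE Js _]]] := main _ (p.+1 * p.+1)%N p0.
  apply: (@le_trans _ _ (\int[mu]_(x in D) ((step t p.+1%:R^-1 (p.+1 * p.+1)%N x)%:E
      + (p.+1%:R^-1)%:E))%E).
    apply: ge0_le_integral; first exact: mD.
    - exact: g_ge0.
    - exact: mg.
    - apply: emeasurable_funD; last exact: measurable_cst.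
      by apply/measurable_EFinP; exact: mstep.
    move=> x; rewrite /= in_itv/= andbT => x0; rewrite -EFinD lee_fin -lerBlDr stE//.
    have := @staircase_ge p.+1%:R^-1 (p.+1 * p.+1)%N (x ^+ k.+1) p0 (exprn_ge0 _ x0).
    by rewrite natrM mulfK ?pnatr_eq0.
  rewrite ge0_integralD//.
  - by rewrite JE integral_cst// [X in (_ * X)%E]mD1 mule1 -EFinD lee_fin lerD2r.
  - by move=> x _; rewrite lee_fin step_ge0.
  - by apply/measurable_EFinP; exact: mstep.
have upper : (\int[mu]_(x in D) (x ^+ k.+1)%:E <= (s k.+1)%:E)%E.
  have g_nd x : D x -> {homo g^~ x : p q / (p <= q)%N >-> (p <= q)%E}.
    move=> _ p q pq; rewrite lee_fin le_min ge_min lexx/= ge_min.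
    by apply/orP; right; rewrite ler_nat.
  have limE : (\int[mu]_(x in D) limn (g^~ x) = \int[mu]_(x in D) (x ^+ k.+1)%:E)%E.
    apply: eq_integral => x _; apply/cvg_lim => //.
    apply: cvg_near_cst; near=> p; rewrite /g min_l//.
    have pX : (Num.truncn `|x ^+ k.+1| <= p)%N by near: p; exact: nbhs_infty_ge.
    rewrite (le_trans (ler_norm _))// ltW// (lt_le_trans (truncnS_gt _))//.
    by rewrite ler_nat ltnS.
  have gc : (\int[mu]_(x in D) g p x)%E @[p --> \oo] -->
      (\int[mu]_(x in D) (x ^+ k.+1)%:E)%E.
    by rewrite -limE; exact: (cvg_monotone_convergence mD mg g_ge0 g_nd).
  apply: (lee_cvg_to gc (_ : (s k.+1 + p.+1%:R^-1)%:E @[p --> \oo] --> (s k.+1)%:E)).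
    apply/cvg_EFin; first by near=> p.
    rewrite -[X in _ --> X]addr0; apply: cvgD; first exact: cvg_cst.
    exact: cvg_harmonic.
  by near=> p; exact: g_le.
apply/le_anti; rewrite upper/=.
have X_ge0 : (0 <= \int[mu]_(x in D) (x ^+ k.+1)%:E)%E.
  by apply: integral_ge0 => x; rewrite /= in_itv/= andbT => x0; rewrite lee_fin exprn_ge0.
have Xfin : (\int[mu]_(x in D) (x ^+ k.+1)%:E)%E \is a fin_num.
  by rewrite ge0_fin_numE// (le_lt_trans upper)// ltry.
rewrite -(fineK Xfin) lee_fin.
set I := fine _.
(* The same staircase loses [s (k.+1 * 2)] times [1/(p + 1)] by truncation, plus two steps of height
   [1/(p + 1)]. *)
pose K := s (k.+1 * 2)%N + 2.
have low p : s k.+1 - K * p.+1%:R^-1 <= I.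
  have p0 : 0 < p.+1%:R^-1 :> R by rewrite invr_gt0.
  have [J [t [JE stE _ Js]]] := main _ (p.+1 * p.+1)%N p0.
  have JI : J <= I.
    rewrite -lee_fin fineK// -JE; apply: ge0_le_integral => //.
    - by move=> x _; rewrite lee_fin step_ge0.
    - by apply/measurable_EFinP; exact: mstep.
    move=> x; rewrite /= in_itv/= andbT => x0; rewrite lee_fin stE//.
    by rewrite staircase_le// exprn_ge0.
  have := Js isT; rewrite natrM mulfK ?pnatr_eq0// => Js'.
  rewrite /K mulrDl; set a := s _ * _ in Js' *; set b := p.+1%:R^-1 in Js' *.
  lra.
have lc : s k.+1 - K * p.+1%:R^-1 @[p --> \oo] --> s k.+1 - K * 0.
  apply: cvgB; first exact: cvg_cst.
  by apply: cvgM; [exact: cvg_cst|exact: cvg_harmonic].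
rewrite mulr0 subr0 in lc.
by apply: (ler_cvg_to lc (cvg_cst I)); near=> p; exact: low.
Unshelve. all: by end_near. Qed.

End HellyMoments.

(** * Determinacy criterion *)

Section Assembly.
Context {R : realType}.

Lemma nneseries_bounded (u : nat -> R) : (forall i, 0 < u i) ->
  ((\sum_(0 <= k <oo) (u k)%:E < +oo)%E <->
   exists C, forall n, \sum_(i < n) u i <= C).
Proof.
move=> u0; have uE0 k : (0 <= k)%N -> true -> (0 <= (u k)%:E)%E.
  by move=> _ _; rewrite lee_fin ltW.
split=> [ufin|[C uC]].
  exists (fine (\sum_(0 <= k <oo) (u k)%:E)%E) => n.
  rewrite -lee_fin fineK; last by rewrite ge0_fin_numE//; exact: nneseries_ge0.
  by rewrite -sumEFin -(big_mkord xpredT (fun k => (u k)%:E)); exact: nneseries_lim_ge.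
apply: (@le_lt_trans _ _ C%:E); last exact: ltry.
apply: lime_le; first exact: is_cvg_nneseries.
by near=> n; rewrite /= big_mkord sumEFin lee_fin.
Unshelve. all: by end_near. Qed.

Lemma nneseries_unbounded (u : nat -> R) : (forall i, 0 < u i) ->
  ~ (\sum_(0 <= k <oo) (u k)%:E < +oo)%E ->
  forall e, 0 < e -> exists n, (\sum_(i < n.+1) u i)^-1 <= e.
Proof.
move=> u0 /(contra_not (nneseries_bounded u0).2) unb e e0.
apply: contrapT => small; apply: unb; exists e^-1 => n.
apply: contrapT => /negP; rewrite -ltNge => ne; apply: small.
exists n; rewrite invf_ple ?posrE//; last first.
  by rewrite big_ord_recl ltr_wpDr// sumr_ge0// => i _; exact: ltW.
by rewrite big_ord_recr/= (le_trans (ltW ne))// lerDl ltW.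
Qed.

Variables (s m l : nat -> R).
Hypothesis hstring : associated_string s m l.

Let m_gt0 i : 0 < m i. Proof. by case: hstring => a [b [_ [[]]]]. Qed.
Let l_gt0 i : 0 < l i. Proof. by case: hstring => a [b [_ [[]]]]. Qed.
Let m0 : m 0%N = 1. Proof. by case: hstring => a [b [_ []]]. Qed.

Notation L p := (krylov (fun i => (l i)^-1) (fun i => (m i)^-1) p 0%N).

Lemma moment_functionalE (p : {poly R}) : \sum_(k < size p) p`_k * s k = L p.
Proof.
by apply: eq_bigr => k _; rewrite (moments_string hstring) krylovXn.
Qed.

Lemma christoffel_mass x e : 0 < x -> ~ (total_mass m < +oo)%E -> 0 < e ->
  exists (p : {poly R}) c,
    [/\ forall t, 0 <= t -> 0 <= p.[t], c * p.[- x] = 1 & `|c| * L p <= e].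
Proof.
move=> x0 minf e0; have nx : - x <= 0 by rewrite oppr_le0 ltW.
have [n ne] := nneseries_unbounded m_gt0 minf e0.
have [|i|r [r1 Lr]] := @christoffel_bound _ m l
    (fun i => (string_poly m l i).1) 1 m (- x) n m_gt0.
- by move=> i j; rewrite mulr1 string_moment_ff.
- exact: (string_poly_ge1 m_gt0 l_gt0 m0 i nx).1.
exists (r * r), 1; split=> [t _||].
- by rewrite hornerM -expr2 sqr_ge0.
- by rewrite hornerM r1 !mulr1.
- by rewrite normr1 mul1r -[r * r]mulr1 (le_trans Lr).
Qed.

(** The polynomial [r^2 X] is nonnegative only on the half-line, which suffices. Its value at [-x]
    is [-x], hence [c = -1/x] and the tolerance [x e]. *)
Lemma christoffel_length x e : 0 < x -> ~ (total_length l < +oo)%E -> 0 < e ->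
  exists (p : {poly R}) c,
    [/\ forall t, 0 <= t -> 0 <= p.[t], c * p.[- x] = 1 & `|c| * L p <= e].
Proof.
move=> x0 linf e0; have nx : - x <= 0 by rewrite oppr_le0 ltW.
have [n ne] := nneseries_unbounded l_gt0 linf (mulr_gt0 x0 e0).
have [|i|r [r1 Lr]] := @christoffel_bound _ m l
    (fun i => (string_poly m l i).2) 'X l (- x) n l_gt0.
- by move=> i j; rewrite string_moment_hh.
- exact: (string_poly_ge1 m_gt0 l_gt0 m0 i nx).2.
exists (r * r * 'X), (- x^-1); split=> [t t0||].
- by rewrite !hornerM hornerX mulr_ge0// -expr2 sqr_ge0.
- by rewrite !hornerM hornerX r1 !mul1r mulrNN mulVf ?gt_eqF.
- by rewrite normrN gtr0_norm ?invr_gt0// ler_pdivrMl// (le_trans Lr).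
Qed.

Lemma determinate_of_infinite :
  ~ ((total_mass m < +oo)%E /\ (total_length l < +oo)%E) ->
  ~ stieltjes_indeterminate s.
Proof.
move=> inf [rho1 [rho2 [sol1 sol2 [B mB]]]]; apply.
apply: (stieltjes_solution_unique sol1 sol2) mB => x x0.
apply: (eq_stieltjes_transform sol1 sol2 x0) => e e0.
have [p [c [p0 cp pe]]] : exists (p : {poly R}) c,
    [/\ forall t, 0 <= t -> 0 <= p.[t], c * p.[- x] = 1 & `|c| * L p <= e].
  move/not_andP : inf => [minf|linf]; first exact: christoffel_mass.
  exact: christoffel_length.
by exists p, c; split=> //; rewrite moment_functionalE.
Qed.

Hypothesis s0 : s 0%N = 1.

(** The two limits are told apart by the mass of []-oo, 0]]: at least [1/M] in the free case, at
    most [1/(2M)] in the fixed one. *)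
Lemma indeterminate_of_finite :
  (total_mass m < +oo)%E -> (total_length l < +oo)%E -> stieltjes_indeterminate s.
Proof.
move=> /(nneseries_bounded m_gt0)[M mM] /(nneseries_bounded l_gt0)[Len lL].
have M0 : 0 < M by rewrite (lt_le_trans _ (mM 1%N))// big_ord1.
have moment N (w d : 'I_N.+1 -> R) k :
    (forall p : {poly R}, (size p <= N.+1)%N -> \sum_j w j * p.[d j] = L p) ->
    (k <= N)%N -> \sum_j w j * d j ^+ k = s k.
  move=> wd kN; rewrite (moments_string hstring) -wd ?size_polyXn//.
  by apply: eq_bigr => j _; rewrite hornerXn.
(* Choice of weights and nodes for all [N] at once, as [helly_moments] expects families. *)
have Pf N := svalP (cid (svalP (cid (fixed_end_quadrature m_gt0 l_gt0 m0 N)))).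
have Pr N := svalP (cid (svalP (cid (free_end_quadrature m_gt0 l_gt0 m0 N)))).
have [mu1 [sol1 ge1 _]] := helly_moments s0
  (fun N => let: And4 w0 _ _ _ := Pr N in w0)
  (fun N => let: And4 _ d0 _ _ := Pr N in d0)
  (fun N k kN => let: And4 _ _ wd _ := Pr N in moment N _ _ k wd kN).
have [mu2 [sol2 _ le2]] := helly_moments s0
  (fun N => let: And4 w0 _ _ _ := Pf N in w0)
  (fun N => let: And4 _ d0 _ _ := Pf N in d0)
  (fun N k kN => let: And4 _ _ wd _ := Pf N in moment N _ _ k wd kN).
exists mu1, mu2; split=> //.
exists (`]-oo, 0]%classic : set (measurableTypeR R)); first exact: measurable_itv.
have mass1 : (M^-1%:E <= mu1 `]-oo, 0%R]%classic)%E.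
  apply: ge1 => N; have [_ _ _ ->] := Pr N.
  rewrite lef_pV2 ?posrE// (lt_le_trans ltr01)// -m0 big_ord_recl.
  by rewrite lerDl sumr_ge0// => i _; exact: ltW.
move=> mu12; move: mass1; rewrite mu12.
have Len0 : 0 < Len by rewrite (lt_le_trans _ (lL 1%N))// big_ord1.
(* Chosen so that the fixed-end bound [e * Len] is half of [1/M]. *)
pose e := M^-1 / 2 / Len.
have e0 : 0 < e by rewrite !divr_gt0// invr_gt0.
have mass2 : (mu2 `]-oo, 0%R]%classic <= (e * Len)%:E)%E.
  apply: (le2 0 e) => // N; have [_ _ _ /(_ _ e0) we] := Pf N.
  by rewrite (le_trans we)// ler_wpM2l// ltW.
move=> /le_trans /(_ mass2); rewrite lee_fin /e divfK ?gt_eqF//.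
by rewrite leNgt ltr_pdivrMr// ltr_pMr ?invr_gt0// ltr1n.
Qed.

End Assembly.

Theorem proposition13 (R : realType) (s : nat -> R)
  (hs0 : s 0%N = 1%R)
  (hH : forall N : nat, posdefmx (hankel s N))
  (hH' : forall N : nat, posdefmx (hankel_shift s N))
  (m l : nat -> R)
  (hstring : associated_string s m l) :
  stieltjes_indeterminate s <->
  (total_mass m < +oo)%E /\ (total_length l < +oo)%E.
Proof.
split=> [ind|[mfin lfin]]; last exact: (indeterminate_of_finite hstring hs0).
by apply: contrapT => /(determinate_of_infinite hstring).
Qed.
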